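(* Let $M$ be the closed oriented $4$-manifold obtained by gluing two copies of $S^1\times N_a$, each minus an open tubular neighbourhood of the torus $T$, along the identification that covers the identity $T\to T$ and uses the product framings, as described in the context ($M$ is a genus $2$ surface bundle over the torus whose monodromy is trivial in one direction of the base and a product of two Dehn twists about disjoint curves in the other). Then $M$ is a spin manifold.
   Context: Let $T^2$ be the torus with standard generating curves $a,b$, and let $\tau:T^2\to T^2$ be the Dehn twist about $a$, with $\tau_*(a)=a$, $\tau_*(b)=ab$, supported in an annular neighbourhood of a curve parallel to $a$. Let $D\subset T^2$ be a closed disc with centre $q$, disjoint from the support of $\tau$. Let $N_a$ be the mapping torus of $\tau$, i.e. $T^2\times[0,1]$ with its two ends identified by $\tau$, with projection $\pi: N_a\to S^1=[0,1]/(0\sim 1)$. As $\tau$ is the identity on $D$, $N_a$ contains the solid torus $D\times S^1$ (the image of $D\times[0,1]$), with core circle $\{q\}\times S^1$, mapped by $\pi$ onto $S^1$ via projection to the second factor. The manifold $S^1\times N_a$ is a torus bundle over $S^1\times S^1$ with projection $\mathrm{id}\times\pi$. It contains the section $T=S^1\times(\{q\}\times S^1)$ with tubular neighbourhood $S^1\times(D\times S^1)\cong D\times T^2$, where the $T^2$ factor is the base, with coordinates $(z_0,z_1)$. Take two copies of $S^1\times N_a$, remove the interior of this tubular neighbourhood from each, and glue the resulting boundaries $\partial D\times T^2$ by $(u,z_0,z_1)\mapsto(r(u),z_0,z_1)$, where $r:\partial D\to\partial D$ is a reflection, so that the gluing map is orientation-reversing, covers the identity of $T$, and commutes with the projections to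 $S^1\times S^1$. The result $M$ is a bundle over $S^1\times S^1$ with fibre the closed genus $2$ surface $T^2\# T^2$. *)

(* Defs.v *)
From HB Require Import structures.
From mathcomp Require Import all_boot all_order all_algebra.
From mathcomp Require Import all_classical all_reals all_analysis.

Set Implicit Arguments.
Unset Strict Implicit.
Unset Printing Implicit Defensive.

Import Order.TTheory GRing.Theory Num.Theory.
Import numFieldNormedType.Exports.

Local Open Scope classical_set_scope.
Local Open Scope ring_scope.

(* Vectors are rows, as in the library: the matrix J := jacobian f x acts by
   v |-> v *m J, and the rows of a square matrix are read as a frame. *)

Fixpoint iter_deriv (R : realType) (n m : nat) (vs : seq 'rV[R]_n)
    (f : 'rV[R]_n -> 'rV[R]_m) : 'rV[R]_n -> 'rV[R]_m :=
  if vs is v :: vs' then fun x => 'D_v (iter_deriv vs' f) x else f.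

(* C^oo on a neighbourhood of x. *)
Definition smooth_at (R : realType) (n m : nat)
    (f : 'rV[R]_n -> 'rV[R]_m) (x : 'rV[R]_n) : Prop :=
  \forall y \near x, forall vs, differentiable (iter_deriv vs f) y.

(* Smooth n-manifold without boundary, with an oriented atlas.  The chart i is
   mfd_crd i on the open set mfd_dom i, and mfd_par i is its inverse; outside
   of mfd_dom i (resp. of its image) these functions carry no meaning. *)
Record oriented_manifold (R : realType) (n : nat) := OrientedManifold {
  mfd_space :> topologicalType;
  mfd_index : Type;
  mfd_dom : mfd_index -> set mfd_space;
  mfd_crd : mfd_index -> mfd_space -> 'rV[R]_n;
  mfd_par : mfd_index -> 'rV[R]_n -> mfd_space;
  mfd_hausdorff : hausdorff_space mfd_space;
  mfd_second_countable : @second_countable mfd_space;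
  mfd_cover : forall x, exists i, mfd_dom i x;
  mfd_dom_open : forall i, open (mfd_dom i);
  mfd_img_open : forall i, open (mfd_crd i @` mfd_dom i);
  mfd_crd_continuous :
    forall i x, mfd_dom i x -> {for x, continuous (mfd_crd i)};
  mfd_par_continuous :
    forall i x, mfd_dom i x -> {for mfd_crd i x, continuous (mfd_par i)};
  mfd_crdK : forall i x, mfd_dom i x -> mfd_par i (mfd_crd i x) = x;
  mfd_transition_smooth :
    forall i j x, mfd_dom i x -> mfd_dom j x ->
      smooth_at (mfd_crd j \o mfd_par i) (mfd_crd i x);
  mfd_transition_oriented :
    forall i j x, mfd_dom i x -> mfd_dom j x ->
      0 < \det (jacobian (mfd_crd j \o mfd_par i) (mfd_crd i x))
}.

Arguments mfd_dom {R n} M i : rename.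
Arguments mfd_crd {R n} M i : rename.
Arguments mfd_par {R n} M i : rename.

(* Orientation preserving local diffeomorphism from the open set W to M. *)
Definition local_diffeo (R : realType) (n : nat) (M : oriented_manifold R n)
    (W : set 'rV[R]_n) (f : 'rV[R]_n -> M) : Prop :=
  [/\ forall p, W p -> {for p, continuous f},
      forall A, A `<=` W -> open A -> open (f @` A)
    & forall i p, W p -> mfd_dom M i (f p) ->
        smooth_at (mfd_crd M i \o f) p
        /\ 0 < \det (jacobian (mfd_crd M i \o f) p)].

(* Row k of E i x lists the coordinates, in the chart i, of the k-th vector of
   the frame of T_x M. *)
Definition oriented_frame_field (R : realType) (n : nat)
    (M : oriented_manifold R n) (U : set M)
    (E : mfd_index M -> M -> 'M[R]_n) : Prop :=
  forall i x, U x -> mfd_dom M i x ->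
    [/\ {for x, continuous (E i)},
        0 < \det (E i x)
      & forall j, mfd_dom M j x ->
          E j x = E i x *m jacobian (mfd_crd M j \o mfd_par M i)
                                    (mfd_crd M i x)].

Definition sqnorm (R : realType) (n : nat) (v : 'rV[R]_n) : R :=
  \sum_i v ord0 i ^+ 2.

(* Quaternions: the row (a, b, c, d) is a + b i + c j + d k. *)
Definition qmul (R : realType) (p q : 'rV[R]_4) : 'rV[R]_4 :=
  let p_ (i : nat) := p ord0 (inord i) in
  let q_ (i : nat) := q ord0 (inord i) in
  \row_(i < 4)
    [:: p_ 0%N * q_ 0%N - p_ 1%N * q_ 1%N - p_ 2%N * q_ 2%N - p_ 3%N * q_ 3%N;
        p_ 0%N * q_ 1%N + p_ 1%N * q_ 0%N + p_ 2%N * q_ 3%N - p_ 3%N * q_ 2%N;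
        p_ 0%N * q_ 2%N - p_ 1%N * q_ 3%N + p_ 2%N * q_ 0%N + p_ 3%N * q_ 1%N;
        p_ 0%N * q_ 3%N + p_ 1%N * q_ 2%N - p_ 2%N * q_ 1%N + p_ 3%N * q_ 0%N]`_i.

Definition qconj (R : realType) (q : 'rV[R]_4) : 'rV[R]_4 :=
  \row_(i < 4) (if i == ord0 then q ord0 i else - q ord0 i).

(* Spin(4) = Sp(1) x Sp(1), with double covering Spin(4) -> SO(4) sending
   (p, q) to the rotation v |-> p v q^-1 of R^4. *)
Definition Spin4 (R : realType) : set ('rV[R]_4 * 'rV[R]_4) :=
  [set g | sqnorm g.1 = 1 /\ sqnorm g.2 = 1].

Definition spin_mul (R : realType) (g h : 'rV[R]_4 * 'rV[R]_4) :=
  (qmul g.1 h.1, qmul g.2 h.2).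

Definition spin_act (R : realType) (g : 'rV[R]_4 * 'rV[R]_4) (v : 'rV[R]_4) :=
  qmul (qmul g.1 v) (qconj g.2).

(* Spin structure on the tangent bundle in terms of cocycles: local oriented
   frames e_j whose transition functions take values in SO(4) and come with
   lifts g_jk to Spin(4) that satisfy the cocycle condition.  The frames e_j
   are the orthonormal ones for a unique metric, so a Riemannian metric is
   chosen implicitly.  The frame e_j at x is the isomorphism R^4 -> T_x M
   sending v to v *m E j i x in the chart i, and the equation between frames
   reads e_k = e_j o spin_act (g_jk). *)
Definition spin_manifold (R : realType) (M : oriented_manifold R 4) : Prop :=
  exists (J : Type) (U : J -> set M) (E : J -> mfd_index M -> M -> 'M[R]_4)
         (g : J -> J -> M -> 'rV[R]_4 * 'rV[R]_4),
    [/\ (forall j, open (U j)) /\ (forall x, exists j, U j x),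
        forall j, oriented_frame_field (U j) (E j),
        forall j k x, U j x -> U k x ->
          Spin4 (g j k x) /\ {for x, continuous (g j k)},
        forall j k x i v, U j x -> U k x -> mfd_dom M i x ->
          v *m E k i x = spin_act (g j k x) v *m E j i x
      & forall j k l x, U j x -> U k x -> U l x ->
          spin_mul (g j k x) (g k l x) = g j l x].

(* T^2 = R^2/Z^2, with a and b the images of the x-axis and the y-axis.  The
   function beta describes the Dehn twist tau (x, y) = (x + beta y, y); the
   second condition makes tau well defined on T^2 with tau_* b = a b, and
   (x, y) is fixed by tau exactly when beta y is an integer. *)
Definition twist_profile (R : realType) (beta : R -> R) : Prop :=
  (forall (n : nat) (y : R), derivable (derive1n n beta) y 1)
  /\ (forall y, beta (y + 1) = beta y + 1).

(* The points q + v with |v| <= rho form an embedded closed disc in T^2. It is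
   disjoint from the (closed) support of tau, a union of horizontal circles:
   near every height reached by the disc, tau is the identity. *)
Definition disc_off_support (R : realType) (beta : R -> R)
    (q : 'rV[R]_2) (rho : R) : Prop :=
  [/\ 0 < rho, rho < 2^-1
    & forall y, `|y - q ord0 ord_max| <= rho ->
        \forall t \near y, exists k : int, beta t = k%:~R].

(* Points of R^4 are (x, y, z0, z1): fibre coordinates u = (x, y) followed by
   base coordinates z = (z0, z1). *)
Definition fib (R : realType) (p : 'rV[R]_4) : 'rV[R]_2 :=
  lsubmx (p : 'rV[R]_(2 + 2)).
Definition bas (R : realType) (p : 'rV[R]_4) : 'rV[R]_2 :=
  rsubmx (p : 'rV[R]_(2 + 2)).
Definition pt (R : realType) (u z : 'rV[R]_2) : 'rV[R]_4 := row_mx u z.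

Definition vec2 (R : realType) (a b : R) : 'rV[R]_2 :=
  \row_i (if i == ord0 then a else b).
Definition int_vec (R : realType) (k l : int) : 'rV[R]_2 :=
  vec2 k%:~R l%:~R.

(* The n-th power of the lift (x, y) |-> (x + beta y, y) of tau to R^2. *)
Definition twist_pow (R : realType) (beta : R -> R) (n : int) (u : 'rV[R]_2) :
    'rV[R]_2 :=
  u + vec2 (n%:~R * beta (u ord0 ord_max)) 0.

(* S^1 x N_a is the quotient of R^4 by this relation: u is taken modulo Z^2,
   z0 modulo Z, and (u, z0, z1 + 1) is identified with (tau u, z0, z1). *)
Definition same_point (R : realType) (beta : R -> R) (p p' : 'rV[R]_4) : Prop :=
  exists k l m n : int,
    p' = pt (twist_pow beta n (fib p) + int_vec R k l)
            (bas p + int_vec R m (- n)).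

(* The preimage in R^4 of S^1 x N_a minus the open solid D x T^2, and its
   interior. *)
Definition exterior (R : realType) (q : 'rV[R]_2) (rho : R) : set 'rV[R]_4 :=
  [set p | forall k l : int, rho ^+ 2 <= sqnorm (fib p - q - int_vec R k l)].
Definition exterior_int (R : realType) (q : 'rV[R]_2) (rho : R) :
    set 'rV[R]_4 :=
  [set p | forall k l : int, rho ^+ 2 < sqnorm (fib p - q - int_vec R k l)].

Definition reflection (R : realType) (r : 'M[R]_2) : Prop :=
  r *m r^T = 1%:M /\ \det r = -1.

(* The gluing map (u, z0, z1) |-> (r u, z0, z1) of the boundary. *)
Definition glue_map (R : realType) (q : 'rV[R]_2) (r : 'M[R]_2)
    (p : 'rV[R]_4) : 'rV[R]_4 :=
  pt (q + (fib p - q) *m r) (bas p).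

(* Equality in M of the point p of the copy c with the point p' of the copy
   c', for p and p' in the exterior. *)
Definition glued_point (R : realType) (beta : R -> R) (q : 'rV[R]_2) (rho : R)
    (r : 'M[R]_2) (c : bool) (p : 'rV[R]_4) (c' : bool) (p' : 'rV[R]_4) :
    Prop :=
  if c == c' then same_point beta p p'
  else exists p1, [/\ same_point beta p p1, sqnorm (fib p1 - q) = rho ^+ 2
                    & same_point beta (glue_map q r p1) p'].

(* The collars on the two sides of the glued boundary are radial: the inversion
   in the circle of radius rho, composed with r, carries the points just inside
   D to points just outside of D, and it is the gluing map on the circle. *)
Definition collar_map (R : realType) (q : 'rV[R]_2) (rho : R) (r : 'M[R]_2)
    (p : 'rV[R]_4) : 'rV[R]_4 :=
  pt (q + (rho ^+ 2 / sqnorm (fib p - q)) *: ((fib p - q) *m r)) (bas p).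

(* The annulus rho^2/rho' < |u - q| < rho', times R^2; it is invariant under
   collar_map. *)
Definition collar (R : realType) (q : 'rV[R]_2) (rho rho' : R) :
    set 'rV[R]_4 :=
  [set p | (rho ^+ 2 / rho') ^+ 2 < sqnorm (fib p - q) < rho' ^+ 2].

Definition seam (R : realType) (T : Type) (q : 'rV[R]_2) (rho : R)
    (r : 'M[R]_2) (P : bool -> 'rV[R]_4 -> T) (p : 'rV[R]_4) : T :=
  if rho ^+ 2 <= sqnorm (fib p - q) then P false p
  else P true (collar_map q rho r p).

(* M is obtained from the two copies (indexed by bool) of the exterior.  The
   map P c is the projection from the exterior in R^4 to the copy c inside M
   (its values off the exterior carry no meaning).  As a set, M is the union of
   the two copies with exactly the prescribed identifications; its oriented
   smooth structure is the one of S^1 x N_a away from the glued boundary, and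
   the one defined by the collars along it. *)
Definition glued_manifold (R : realType) (beta : R -> R) (q : 'rV[R]_2)
    (rho : R) (r : 'M[R]_2) (M : oriented_manifold R 4) : Prop :=
  exists P : bool -> 'rV[R]_4 -> M,
    [/\ forall x, exists c p, exterior q rho p /\ P c p = x,
        forall c p c' p', exterior q rho p -> exterior q rho p' ->
          (P c p = P c' p' <-> glued_point beta q rho r c p c' p'),
        forall c, local_diffeo (exterior_int q rho) (P c)
      & exists rho', [/\ rho < rho', rho' < 2^-1
          & local_diffeo (collar q rho rho') (seam q rho r P)]].

(* Main.v *)
From HB Require Import structures.
Require Import Defs.
From mathcomp Require Import all_boot all_order all_algebra.
From mathcomp Require Import all_classical all_reals all_analysis.
From mathcomp Require Import ring lra zify.

Set Implicit Arguments.
Unset Strict Implicit.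
Unset Printing Implicit Defensive.
Import Order.TTheory GRing.Theory Num.Theory.
Import numFieldNormedType.Exports.
Local Open Scope classical_set_scope.
Local Open Scope ring_scope.

(** M is even parallelizable, and a global oriented frame gives a spin structure
    with trivial transition functions.
    On S^1 x N_a the frame dx, dy - z1 beta'(y) dx, dz0, dz1 of R^4 is invariant
    under all identifications, and it is the coordinate frame near the removed
    D x T^2, where beta is locally constant.  Across the seam the two coordinate
    frames differ, up to scaling, by r composed with the reflection in the
    direction of u - q: a loop of rotations of the fibre plane of winding number
    2, hence contractible in SO(4).  The contraction is explicit: write r as a
    reflection and tilt both reflecting directions into the base direction z0
    until they coincide. *)

(** * Calculus of matrix-valued functions *)

(** The inversion [w |-> rho^2 w / |w|^2] has differential [rho^2 / |w|^2] times the reflection in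
    the direction w: this is where the reflection in the direction of u - q comes from. That
    direction turns once around the circle, and a product of two plane reflections rotates by twice
    the angle between their directions, whence the winding number 2. The frame is built on open sets
    of R^4 and descends to M because any two parameters of the same point are related by a local map
    that carries one frame to the other. Near the hole this is tractable for two reasons. On a tube
    of radius rho2 < 1/2 where [beta] is locally an integer, the identifications reduce to
    translations of the base; and the seam frame depends on the fibre coordinates alone, so these
    translations preserve it. *)

Lemma cvg_mx (T : topologicalType) (K : numFieldType) m n
    (f : T -> 'M[K]_(m, n)) (x : T) :
  (forall i j, {for x, continuous (fun y => f y i j)}) ->
  {for x, continuous f}.
Proof.
move=> fx A /= [P PA sPA].
have : \forall y \near x, forall i j, P i j (f y i j).
  have H i : \forall y \near x, forall j, P i j (f y i j).
    by apply: filter_forall => j; apply: (fx i j); exact: PA.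
  exact: filter_forall H.
by apply: filterS => y Py; apply: sPA.
Qed.

Lemma continuous_mx_coord (T : topologicalType) (K : numFieldType) m n
    (f : T -> 'M[K]_(m, n)) (x : T) i j :
  {for x, continuous f} -> {for x, continuous (fun y => f y i j)}.
Proof.
by move=> fx; apply: (@continuous_comp _ _ _ f (fun N : 'M[K]_(m, n) => N i j));
  [exact: fx | exact: coord_continuous].
Qed.

Lemma cvg_sum_seq (T : Type) (F : set_system T) (K : numFieldType) (I : Type)
    (s : seq I) (f : I -> T -> K) (l : I -> K) : Filter F ->
  (forall i, f i x @[x --> F] --> l i) ->
  \sum_(i <- s) f i x @[x --> F] --> \sum_(i <- s) l i.
Proof.
move=> FF fl; elim: s => [|i s IHs].
  rewrite big_nil; under eq_cvg do rewrite big_nil.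
  exact: cvg_cst.
rewrite big_cons; under eq_cvg do rewrite big_cons.
exact: cvgD (fl i) IHs.
Qed.

Lemma continuous_mulmx (T : topologicalType) (K : numFieldType) m n p
    (f : T -> 'M[K]_(m, n)) (g : T -> 'M[K]_(n, p)) (x : T) :
  {for x, continuous f} -> {for x, continuous g} ->
  {for x, continuous (fun y => f y *m g y)}.
Proof.
move=> fx gx; apply: cvg_mx => i j.
have E : (fun y => (f y *m g y) i j) = (fun y => \sum_k f y i k * g y k j).
  by apply/funext => y; rewrite mxE.
rewrite E; apply: cvg_sum_seq => k.
by apply: cvgM; apply: continuous_mx_coord.
Qed.

Section jacobian_theory.
Context {R : realType} {n m : nat}.
Implicit Types f : 'rV[R]_n -> 'rV[R]_m.

Lemma jacobian_eqP f x (A : 'M[R]_(n, m)) : differentiable f x ->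
  (forall v, 'D_v f x = v *m A) -> jacobian f x = A.
Proof.
move=> df H; apply/row_matrixP => i; rewrite !rowE -H.
by rewrite deriveEjacobian.
Qed.

Lemma jacobian_near_eq f g x : differentiable f x -> differentiable g x ->
  (\forall y \near x, f y = g y) -> jacobian f x = jacobian g x.
Proof.
move=> df dg fg; apply: jacobian_eqP => // v.
by rewrite -deriveEjacobian //; apply: near_eq_derive.
Qed.

Lemma smooth_at_differentiable f x : smooth_at f x -> differentiable f x.
Proof. by move=> /nbhs_singleton /(_ [::]). Qed.

(** Near x the entries of the Jacobian are derivatives along basis vectors, and [smooth_at] makes
    these differentiable, hence continuous. *)
Lemma smooth_at_continuous_jacobian f x :
  smooth_at f x -> {for x, continuous (jacobian f)}.
Proof.
move=> fx; apply: cvg_mx => i j.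
have H : \forall y \near x, 'D_(delta_mx 0 i) f y 0 j = jacobian f y i j.
  apply: filterS fx => y /(_ [::]) /= fy.
  by rewrite deriveEjacobian // -rowE mxE.
have Hc : {for x, continuous (fun y => 'D_(delta_mx 0 i) f y 0 j)}.
  apply: (@continuous_mx_coord _ _ _ _ (fun y => 'D_(delta_mx 0 i) f y)).
  apply: differentiable_continuous.
  exact: (nbhs_singleton fx [:: delta_mx 0 i]).
have E : 'D_(delta_mx 0 i) f x 0 j = jacobian f x i j := nbhs_singleton H.
move: Hc; rewrite /prop_for /continuous_at E; apply: cvg_trans.
exact: (near_eq_cvg H).
Qed.

Lemma jacobian_coord f x (A : 'M[R]_(n, m)) :
  (forall j, is_diff x (fun y => f y 0 j : R) (fun v => (v *m A) 0 j)) ->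
  differentiable f x /\ jacobian f x = A.
Proof.
move=> H.
have df : differentiable f x.
  have -> : f = \sum_j (fun y => f y 0 j *: delta_mx 0 j).
    by apply/funext => y; rewrite fct_sumE {1}[f y]row_sum_delta.
  apply: differentiable_sum => j; apply: differentiableZl.
  by have [] := H j.
split=> //; apply: jacobian_eqP => // v.
rewrite derive_mx; last exact: diff_derivable.
apply/matrixP => i j; rewrite mxE !ord1 deriveE; last by have [] := H j.
by have [_ ->] := H j.
Qed.
End jacobian_theory.

Lemma jacobian_comp (R : realType) n m p (f : 'rV[R]_n -> 'rV[R]_m)
    (g : 'rV[R]_m -> 'rV[R]_p) x :
  differentiable f x -> differentiable g (f x) ->
  jacobian (g \o f) x = jacobian f x *m jacobian g (f x).
Proof.
move=> df dg; apply: jacobian_eqP; first exact: differentiable_comp.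
move=> v; rewrite deriveE; last exact: differentiable_comp.
by rewrite diff_comp //= mulmxA -!deriveEjacobian // !deriveE.
Qed.

(** * Gluing local frames *)

(** [h] is a change of parameters near p turning [f'] into [f]; the last clause makes the frames
    pushed forward from p and p' agree. No inverse of [h] is asked for, so the relation is
    directed. *)
Definition intertwines (R : realType) (n : nat) (T : Type)
    (f f' : 'rV[R]_n -> T) (G G' : 'rV[R]_n -> 'M[R]_n) (p p' : 'rV[R]_n) :=
  exists h : 'rV[R]_n -> 'rV[R]_n,
    [/\ differentiable h p, h p = p', \forall z \near p, f' (h z) = f z
      & G p *m jacobian h p = G' p'].

Section glue_frames.
Context {R : realType} {n : nat} (M : oriented_manifold R n).

(** The chain rule for [f' \o h = f], read in the chart i. *)
Lemma pushed_frame_intertwines (W W' : set 'rV[R]_n) (f f' : 'rV[R]_n -> M)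
    G G' p p' i :
  local_diffeo W f -> local_diffeo W' f' -> W p -> W' p' ->
  mfd_dom M i (f p) -> intertwines f f' G G' p p' ->
  G p *m jacobian (mfd_crd M i \o f) p = G' p' *m jacobian (mfd_crd M i \o f') p'.
Proof.
move=> [_ _ fW] [_ _ fW'] Wp Wp' ip [h [dh hp' fh <-]]; subst p'.
have fpE : f' (h p) = f p := nbhs_singleton fh.
have [sf _] := fW i p Wp ip.
have ip' : mfd_dom M i (f' (h p)) by rewrite fpE.
have [sf' _] := fW' i (h p) Wp' ip'.
have df := smooth_at_differentiable sf.
have df' := smooth_at_differentiable sf'.
rewrite -mulmxA; congr (_ *m _); rewrite -(jacobian_comp dh df').
apply: jacobian_near_eq => //; first exact: differentiable_comp.
by apply: filterS fh => z /= ->.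
Qed.

Variables (A : Type) (W : A -> set 'rV[R]_n) (f : A -> 'rV[R]_n -> M).
Variable G : A -> 'rV[R]_n -> 'M[R]_n.
Hypothesis W_open : forall a, open (W a).
Hypothesis f_diffeo : forall a, local_diffeo (W a) (f a).
Hypothesis G_continuous : forall a p, W a p -> {for p, continuous (G a)}.
Hypothesis G_det : forall a p, W a p -> 0 < \det (G a p).
Hypothesis f_cover : forall x, exists a p, W a p /\ f a p = x.
Hypothesis f_compat : forall a b p p', W a p -> W b p' -> f a p = f b p' ->
  intertwines (f a) (f b) (G a) (G b) p p' \/
  intertwines (f b) (f a) (G b) (G a) p' p.

Lemma oriented_frame_field_glue : exists E, oriented_frame_field [set: M] E.
Proof.
have f_lift x : exists ap : A * 'rV[R]_n, W ap.1 ap.2 /\ f ap.1 ap.2 = x.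
  by have [a [p H]] := f_cover x; exists (a, p).
have [s sP] := choice f_lift.
pose E (i : mfd_index M) (x : M) : 'M[R]_n :=
  G (s x).1 (s x).2 *m jacobian (mfd_crd M i \o f (s x).1) (s x).2.
(* The value does not depend on the preimage chosen by [s], so near each point E can be computed
   with a fixed parametrization. *)
have EE i a p : W a p -> mfd_dom M i (f a p) ->
    E i (f a p) = G a p *m jacobian (mfd_crd M i \o f a) p.
  move=> Wp ip; have [Ws sx] := sP (f a p); rewrite /E.
  have [H|H] := f_compat Ws Wp sx.
    by apply: (pushed_frame_intertwines (f_diffeo _) (f_diffeo _) Ws Wp _ H);
      rewrite sx.
  by apply/esym; apply: (pushed_frame_intertwines (f_diffeo _) (f_diffeo _) Wp Ws _ H).
exists E => i x _ ix; have [a [p [Wp fpx]]] := f_cover x; subst x.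
have [fc fo fs] := f_diffeo a; have [sp detp] := fs i p Wp ix.
have near_p : \forall z \near p, W a z /\ mfd_dom M i (f a z).
  near=> z; split; near: z; first exact: open_nbhs_nbhs.
  by apply: (fc p Wp); apply: open_nbhs_nbhs; split=> //; exact: mfd_dom_open.
split.
(* Continuity is checked on the parameter side: [f a] is open, so the image of a small neighbourhood
   of p is a neighbourhood of [f a p]. No local inverse of [f a] is needed. *)
- move=> V; rewrite /= EE // => VE.
  have : \forall z \near p, V (G a z *m jacobian (mfd_crd M i \o f a) z).
    apply: (continuous_mulmx _ _ VE); first exact: G_continuous.
    exact: smooth_at_continuous_jacobian.
  move=> /(filterI near_p).
  rewrite nbhsE => -[] Q [Qo Qp] QV.
  have QW : Q `<=` W a by move=> z /QV [[]].
  have fQ := fo Q QW Qo.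
  apply: filterS (open_nbhs_nbhs (conj fQ _)); last by exists p.
  by move=> _ [z /QV [[Wz iz] Vz] <-]; rewrite /= EE.
- by rewrite EE // det_mulmx mulr_gt0 // G_det.
(* The chart j composed with [f a] factors through the chart i near p; the transition law is its
   chain rule. *)
- move=> j jx; rewrite (EE _ _ _ Wp jx) (EE _ _ _ Wp ix).
  have dij := smooth_at_differentiable (mfd_transition_smooth ix jx).
  have dfi := smooth_at_differentiable sp.
  have [sj _] := fs j p Wp jx.
  rewrite -mulmxA; congr (_ *m _).
  rewrite -(jacobian_comp dfi dij).
  apply: jacobian_near_eq; first exact: smooth_at_differentiable.
    exact: differentiable_comp dfi dij.
  by apply: filterS near_p => z [_ iz] /=; rewrite mfd_crdK.
Unshelve. all: by end_near. Qed.

End glue_frames.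

(** * The spin structure defined by a global frame *)

Definition quat1 (R : realType) : 'rV[R]_4 := delta_mx 0 0.

Lemma quat1E (R : realType) (i : nat) : (i < 4)%N ->
  quat1 R ord0 (inord i) = (i == 0%N)%:R.
Proof. by move=> i4; rewrite mxE /= -val_eqE /= inordK. Qed.

Lemma qmul1q (R : realType) (p : 'rV[R]_4) : qmul (quat1 R) p = p.
Proof.
apply/rowP => -[[|[|[|[|//]]]] i4]; rewrite mxE !quat1E //=;
  rewrite !(mul0r, mul1r, subr0, addr0, add0r, sub0r, oppr0); congr (p _ _);
  by apply/val_inj; rewrite /= inordK.
Qed.

Lemma qmulq1 (R : realType) (p : 'rV[R]_4) : qmul p (quat1 R) = p.
Proof.
apply/rowP => -[[|[|[|[|//]]]] i4]; rewrite mxE !quat1E //=;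
  rewrite !(mulr0, mulr1, subr0, addr0, add0r, sub0r, oppr0); congr (p _ _);
  by apply/val_inj; rewrite /= inordK.
Qed.

Lemma qconj1 (R : realType) : qconj (quat1 R) = quat1 R.
Proof.
apply/rowP => i; rewrite !mxE /=; case: eqP => // _; exact: oppr0.
Qed.

Lemma sqnorm_quat1 (R : realType) : sqnorm (quat1 R) = 1.
Proof.
rewrite /sqnorm big_ord_recl big1 ?addr0 => [|i _].
  by rewrite mxE /= expr1n.
by rewrite mxE /= expr0n.
Qed.

Lemma spin_manifold_of_frame (R : realType) (M : oriented_manifold R 4) E :
  oriented_frame_field [set: M] E -> spin_manifold M.
Proof.
move=> HE; exists unit, (fun=> setT), (fun=> E),
  (fun _ _ _ => (quat1 R, quat1 R)).
split=> //.
- by split=> [j|x]; [exact: openT | exists tt].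
- by split; [split; exact: sqnorm_quat1 | exact: cvg_cst].
- by move=> j k x i v _ _ _; rewrite /spin_act /= qconj1 qmulq1 qmul1q.
- by move=> j k l x _ _ _; rewrite /spin_mul /= qmul1q.
Qed.

(** * Reflections *)

Lemma det_1BM (K : comNzRingType) n (x : 'cV[K]_n) (y : 'rV[K]_n) :
  \det (1%:M - x *m y) = 1 - (y *m x) 0 0.
Proof.
(* two block triangular factorizations of the same bordered matrix *)
pose A : 'M[K]_(n + 1) := block_mx 1%:M x y 1%:M.
have A1 : A = block_mx 1%:M 0 y 1%:M *m block_mx 1%:M x 0 (1%:M - y *m x).
  by rewrite mulmx_block !(mul1mx, mulmx1, mul0mx, mulmx0, addr0, add0r) addrC subrK.
have A2 : A = block_mx (1%:M - x *m y) x 0 1%:M *m block_mx 1%:M 0 y 1%:M.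
  by rewrite mulmx_block !(mul1mx, mulmx1, mul0mx, mulmx0, addr0, add0r) subrK.
have := congr1 determinant A1; rewrite {1}A2 !det_mulmx !det_ublock !det_lblock.
by rewrite !det1 !mulr1 !mul1r => ->; rewrite det_mx11 !mxE eqxx.
Qed.

Section householder.
Context {R : realType}.

Lemma sqnormE n (a : 'rV[R]_n) : sqnorm a = (a *m a^T) 0 0.
Proof. by rewrite mxE; apply: eq_bigr => i _; rewrite mxE expr2. Qed.

Lemma sqnorm_ge0 n (a : 'rV[R]_n) : 0 <= sqnorm a.
Proof. by apply: sumr_ge0 => i _; exact: sqr_ge0. Qed.

Lemma sqnormZ n c (a : 'rV[R]_n) : sqnorm (c *: a) = c ^+ 2 * sqnorm a.
Proof. by rewrite mulr_sumr; apply: eq_bigr => i _; rewrite mxE exprMn. Qed.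

Lemma ptEl (u z : 'rV[R]_2) i : pt u z ord0 (@lshift 2 2 i) = u ord0 i.
Proof. exact: row_mxEl. Qed.

Lemma ptEr (u z : 'rV[R]_2) i : pt u z ord0 (@rshift 2 2 i) = z ord0 i.
Proof. exact: row_mxEr. Qed.

Lemma sqnorm_pt (u z : 'rV[R]_2) : sqnorm (pt u z) = sqnorm u + sqnorm z.
Proof.
rewrite /sqnorm (@big_split_ord _ _ _ 2 2); congr (_ + _).
  by apply: eq_bigr => i _; rewrite ptEl.
by apply: eq_bigr => i _; rewrite ptEr.
Qed.

Lemma sqnorm_continuous n : continuous (@sqnorm R n).
Proof.
move=> a.
have H (i : 'I_n) : (fun b : 'rV[R]_n => b ord0 i ^+ 2) x @[x --> a] --> a ord0 i ^+ 2.
  apply: (@continuous_comp _ _ _ (fun b : 'rV[R]_n => b ord0 i) (fun t => t ^+ 2)).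
    exact: coord_continuous.
  exact: exprn_continuous.
exact: (@cvg_sum_seq _ (nbhs a) R _ _ (fun i b => b ord0 i ^+ 2) _ _ H).
Qed.

Definition householder n (a : 'rV[R]_n) : 'M[R]_n :=
  1%:M - (2 / sqnorm a) *: (a^T *m a).

Lemma householderE n (a : 'rV[R]_n) i j :
  householder a i j = (i == j)%:R - 2 / sqnorm a * (a 0 i * a 0 j).
Proof. by rewrite !mxE big_ord_recl big_ord0 !mxE addr0. Qed.

Lemma det_householder n (a : 'rV[R]_n) : sqnorm a != 0 ->
  \det (householder a) = -1.
Proof.
move=> a0; rewrite /householder scalemxAl det_1BM -scalemxAr mxE -sqnormE.
by rewrite divfK //; lra.
Qed.

Lemma householderK n (a : 'rV[R]_n) : sqnorm a != 0 ->
  householder a *m householder a = 1%:M.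
Proof.
move=> a0; rewrite /householder mulmxBl mul1mx mulmxBr mulmx1.
have -> : (2 / sqnorm a) *: (a^T *m a) *m ((2 / sqnorm a) *: (a^T *m a)) =
    (2 / sqnorm a) *: (a^T *m a) + (2 / sqnorm a) *: (a^T *m a).
  rewrite -scalemxAl -scalemxAr mulmxA -(mulmxA a^T a).
  have -> : a *m a^T = (sqnorm a)%:M.
    by rewrite sqnormE; exact: mx11_scalar.
  rewrite mul_mx_scalar -scalemxAl !scalerA -scalerDl; congr (_ *: _).
  by field.
by rewrite opprB addrK subrK.
Qed.

Lemma householder_continuous n (a : 'rV[R]_n) : sqnorm a != 0 ->
  {for a, continuous (@householder n)}.
Proof.
move=> a0.
have Hs : (2 / sqnorm y) @[y --> a] --> 2 / sqnorm a.
  exact: cvgM (cvg_cst _) (cvgV a0 (@sqnorm_continuous n a)).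
have Ht : {for a, continuous (fun y : 'rV[R]_n => y^T)}.
  apply: cvg_mx => i j.
  rewrite (_ : (fun y : 'rV[R]_n => y^T i j) = (fun y => y j i)).
    by rewrite /prop_for /continuous_at; exact: coord_continuous.
  by apply/funext => y; rewrite mxE.
have Hm : {for a, continuous (fun y : 'rV[R]_n => y^T *m y)}.
  exact: continuous_mulmx Ht (@cvg_id _ (nbhs a)).
exact: cvgB (cvg_cst _) (cvgZ Hs Hm).
Qed.

Lemma householder_pt (w : 'rV[R]_2) :
  householder (pt w 0) = block_mx (householder w) 0 0 1%:M :> 'M[R]_(2 + 2).
Proof.
have s0 : sqnorm (0 : 'rV[R]_2) = 0.
  by rewrite /sqnorm big1 // => i _; rewrite mxE expr0n.
apply/matrixP => i j; rewrite [LHS]householderE sqnorm_pt s0 addr0.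
case: (split_ordP i) => i' ->; case: (split_ordP j) => j' ->.
- by rewrite block_mxEul householderE !ptEl eq_lshift.
- by rewrite block_mxEur ptEr !mxE eq_lrshift !mulr0 subrr.
- by rewrite block_mxEdl ptEr !mxE eq_rlshift mul0r mulr0 subrr.
- by rewrite block_mxEdr ptEr !mxE eq_rshift mul0r mulr0 subr0.
Qed.

Lemma lift2_00 : lift ord0 ord0 = 1 :> 'I_2. Proof. exact: val_inj. Qed.

Lemma ord2P (i : 'I_2) : i = 0 \/ i = 1.
Proof. by case: i => [[|[|//]]] ?; [left|right]; exact: val_inj. Qed.

Lemma det_mx2 (A : 'M[R]_2) : \det A = A 0 0 * A 1 1 - A 0 1 * A 1 0.
Proof.
have l10 : lift 1 0 = 0 :> 'I_2 by exact: val_inj.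
rewrite (expand_det_row A 0) !big_ord_recl big_ord0 /cofactor !det_mx11 !mxE.
by rewrite lift2_00 l10 /= expr0 expr1; ring.
Qed.

Lemma sqnorm2 (w : 'rV[R]_2) : sqnorm w = w 0 0 ^+ 2 + w 0 1 ^+ 2.
Proof. by rewrite /sqnorm !big_ord_recl big_ord0 addr0 lift2_00. Qed.

Lemma reflection_householder (r : 'M[R]_2) : reflection r ->
  exists v, sqnorm v != 0 /\ r = householder v.
Proof.
move=> [rr dr].
have [a ra] : exists a, r 0 0 = a by exists (r 0 0).
have [b rb] : exists b, r 0 1 = b by exists (r 0 1).
have [c rc] : exists c, r 1 0 = c by exists (r 1 0).
have [d rd] : exists d, r 1 1 = d by exists (r 1 1).
have coef i j : r i 0 * r j 0 + r i 1 * r j 1 = (i == j)%:R.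
  have := congr1 (fun A : 'M[R]_2 => A i j) rr.
  by rewrite !mxE !big_ord_recl big_ord0 !mxE addr0 lift2_00.
have := coef 0 0; have := coef 0 1; have := coef 1 1 => /=.
rewrite ra rb rc rd => cd1 acbd ab1.
have adbc : a * d - b * c = -1 by rewrite -dr det_mx2 ra rb rc rd.
(* Orthogonality and determinant -1 make the adjugate of r equal to [- r^T], that is c = b and d =
   -a. *)
have cb : c = b.
  have -> : c = a * (a * c + b * d) - b * (a * d - b * c) + c * (1 - (a * a + b * b)) by ring.
  by rewrite adbc acbd ab1; ring.
have da : d = - a.
  have -> : d = b * (a * c + b * d) + a * (a * d - b * c) + d * (1 - (a * a + b * b)) by ring.
  by rewrite adbc acbd ab1; ring.
suff [v [v0 aE bE dE]] : exists v : 'rV[R]_2, [/\ sqnorm v != 0,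
    a = 1 - 2 / sqnorm v * (v 0 0 * v 0 0),
    b = - (2 / sqnorm v * (v 0 0 * v 0 1)) &
    d = 1 - 2 / sqnorm v * (v 0 1 * v 0 1)].
  exists v; split=> //; apply/matrixP => i j; rewrite householderE.
  case: (ord2P i) => ->; case: (ord2P j) => -> /=.
  - by rewrite ra aE.
  - by rewrite rb bE sub0r.
  - by rewrite rc cb bE sub0r (mulrC (v 0 1)).
  - by rewrite rd dE.
(* The row (b, -(1 + a)) spans the (-1)-eigenspace of r, except that it vanishes for a = -1; then r
   is diagonal with entries -1, 1 and the x-axis serves instead. *)
have [a1|a1] := eqVneq (1 + a) 0.
  have a_m1 : a = -1 by lra.
  have b0 : b = 0.
    apply/eqP; rewrite -sqrf_eq0 expr2; apply/eqP.
    by move: ab1; rewrite a_m1 => ?; lra.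
  exists (vec2 1 0); rewrite sqnorm2 !mxE /= expr1n expr0n /= addr0.
  by rewrite oner_eq0; split=> //; lra.
have svE : sqnorm (vec2 b (- (1 + a)) : 'rV[R]_2) = 2 * (1 + a).
  rewrite sqnorm2 !mxE /=.
  have -> : b ^+ 2 + (- (1 + a)) ^+ 2 = (a * a + b * b) + 1 + 2 * a by ring.
  by rewrite ab1; ring.
exists (vec2 b (- (1 + a))); rewrite svE !mxE /=; split.
- by rewrite mulf_neq0 // pnatr_eq0.
- have -> : b * b = 1 - a * a by lra.
  by field.
- by field.
- by rewrite da; field.
Qed.

End householder.

(** * The invariant frame of the mapping torus *)

Section calculus.
Context {R : realType} {V : normedModType R}.
Implicit Types (x : V) (f g df dg : V -> R).

Lemma is_diff_add f g df dg x : is_diff x f df -> is_diff x g dg ->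
  is_diff x (fun y => f y + g y) (fun h => df h + dg h).
Proof. by move=> Hf Hg; exact: is_diffD. Qed.

Lemma is_diff_mul f g df dg x : is_diff x f df -> is_diff x g dg ->
  is_diff x (fun y => f y * g y) (fun h => f x * dg h + g x * df h).
Proof. by move=> Hf Hg; exact: is_diffM. Qed.

Lemma is_diff_const (c : R) x : is_diff x (fun=> c) (fun=> 0).
Proof. exact: is_diff_cst. Qed.

Lemma is_diff_inv f df x : is_diff x f df -> f x != 0 ->
  is_diff x (fun y => (f y)^-1) (fun h => - (f x) ^- 2 * df h).
Proof.
move=> [Hf E] fx0; apply: DiffDef; first exact: differentiableV.
by rewrite diffV // E.
Qed.

Lemma is_diff_comp_real (b : R -> R) f df x : is_diff x f df ->
  derivable b (f x) 1 ->
  is_diff x (fun y => b (f y)) (fun h => df h * derive1 b (f x)).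
Proof.
move=> Hf Hb; have Db : is_diff (f x) b (fun t => t * derive1 b (f x)).
  by apply: DiffDef; [exact/derivable1_diffP | rewrite deriv1E].
exact: (is_diff_comp Hf Db).
Qed.

End calculus.

Lemma is_diff_coord (R : realType) n (x : 'rV[R]_n) i :
  is_diff x (fun y : 'rV[R]_n => y 0 i) (fun h => h 0 i).
Proof.
pose f : 'rV[R]_n -> R := fun y => y 0 i.
have f_lin : linear f by move=> a u v; rewrite /f !mxE.
pose fM := GRing.isLinear.Build _ _ _ _ _ f_lin.
pose fL : {linear _ -> _} := HB.pack f fM.
apply: DiffDef; first exact: differentiable_coord.
by rewrite (@diff_lin _ _ _ fL) //; exact: coord_continuous.
Qed.

Lemma mul_delta_coef (R : realType) m n (h : 'rV[R]_m) i k j :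
  (h *m delta_mx i k : 'rV[R]_n) 0 j = h 0 i * (j == k)%:R.
Proof.
rewrite mxE (bigD1 i) //= big1 ?addr0 => [|l li]; first by rewrite mxE eqxx.
by rewrite mxE (negPf li) mulr0.
Qed.

Section coordinates.
Context {R : realType}.
Implicit Types p : 'rV[R]_4.

Definition ix : 'I_(2 + 2) := lshift 2 ord0.
Definition iy : 'I_(2 + 2) := lshift 2 ord_max.

Lemma fibE p i : fib p 0 i = p 0 (@lshift 2 2 i).
Proof. by rewrite /fib mxE. Qed.

Lemma basE p i : bas p 0 i = p 0 (@rshift 2 2 i).
Proof. by rewrite /bas mxE. Qed.

Lemma fib_pt (u z : 'rV[R]_2) : fib (pt u z) = u.
Proof. exact: row_mxKl. Qed.

Lemma bas_pt (u z : 'rV[R]_2) : bas (pt u z) = z.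
Proof. exact: row_mxKr. Qed.

Lemma pt_fib_bas p : pt (fib p) (bas p) = p.
Proof. exact: (@hsubmxK _ 1 2 2). Qed.

Lemma fib_continuous : continuous (@fib R).
Proof. exact: (@continuous_lsubmx R 1 2 2). Qed.

Lemma bas_continuous : continuous (@bas R).
Proof. exact: (@continuous_rsubmx R 1 2 2). Qed.

Lemma ord_max2 : ord_max = 1 :> 'I_2. Proof. exact: val_inj. Qed.

End coordinates.

Section deck.
Context {R : realType} (beta : R -> R).
Hypothesis hbeta : twist_profile beta.

(** The deck transformations of the universal covering of S^1 x N_a by R^4; n is the power of the
    monodromy and is coupled to the shift of z1 by -n. *)
Definition deck (n k l m : int) (p : 'rV[R]_4) : 'rV[R]_4 :=
  pt (twist_pow beta n (fib p) + int_vec R k l) (bas p + int_vec R m (- n)).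

Definition base_frame (p : 'rV[R]_4) : 'M[R]_(2 + 2) :=
  1%:M - (bas p ord0 ord_max * derive1 beta (fib p ord0 ord_max)) *: delta_mx iy ix.

Lemma profile_derivable y : derivable beta y 1.
Proof. by have [/(_ 0%N)] := hbeta. Qed.

Lemma profile_continuous : continuous beta.
Proof.
by move=> y; apply: differentiable_continuous; apply/derivable1_diffP;
  exact: profile_derivable.
Qed.

Lemma profile_derive_continuous : continuous (derive1 beta).
Proof.
move=> y; apply: differentiable_continuous; apply/derivable1_diffP.
by have [/(_ 1%N)] := hbeta.
Qed.

Lemma profileDz (y : R) (l : int) : beta (y + l%:~R) = beta y + l%:~R.
Proof.
have [_ H] := hbeta.
have Hn (n : nat) z : beta (z + n%:R) = beta z + n%:R.
  elim: n => [|n IH]; first by rewrite !addr0.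
  by rewrite -addn1 natrD !addrA H IH.
case: l => n; first exact: Hn.
rewrite NegzE mulrNz -pmulrn; apply/eqP; rewrite eq_sym subr_eq eq_sym.
by rewrite -Hn subrK.
Qed.

Lemma profile_deriveDz (y : R) (l : int) :
  derive1 beta (y + l%:~R) = derive1 beta y.
Proof.
have E : (fun h => h^-1 *: (beta (h + (y + l%:~R)) - beta (y + l%:~R))) =
    (fun h => h^-1 *: (beta (h + y) - beta y)).
  by apply/funext => h; rewrite addrA !profileDz opprD addrACA subrr addr0.
by rewrite /derive1 E.
Qed.

Lemma deck_jacobian n k l m p :
  differentiable (deck n k l m) p /\
  jacobian (deck n k l m) p =
    1%:M + (n%:~R * derive1 beta (fib p ord0 ord_max)) *: delta_mx iy ix.
Proof.
rewrite fibE; apply: jacobian_coord => j; rewrite -/iy.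
have cj (h : 'rV[R]_(2 + 2)) c : (h *m (1%:M + c *: delta_mx iy ix)) 0 j =
    h 0 j + c * (h 0 iy * (j == 0 :> nat)%:R).
  by rewrite mulmxDr mulmx1 -scalemxAr mxE [in X in _ + X]mxE mul_delta_coef.
case: (@split_ordP 2 2 j) cj => j' -> cj.
  case: (ord2P j') cj => -> cj.
    have -> : (fun y => deck n k l m y 0 (@lshift 2 2 0)) =
        (fun y => (y 0 ix + n%:~R * beta (y 0 iy)) + k%:~R).
      by apply/funext => y; rewrite /deck ptEl !mxE. 
    have D := is_diff_comp_real (is_diff_coord p iy) (@profile_derivable (p 0 iy)).
    apply: (is_diff_eq (is_diff_add (is_diff_add (is_diff_coord p ix)
      (is_diff_mul (is_diff_const n%:~R p) D)) (is_diff_const k%:~R p))).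
    apply/funext => h; rewrite cj /=.
    by rewrite mulr0 !addr0 mulr1; ring.
  have -> : (fun y => deck n k l m y 0 (@lshift 2 2 1)) =
      (fun y => y 0 iy + l%:~R).
    by apply/funext => y; rewrite /deck ptEl !mxE /= addr0 /iy ord_max2.
  apply: (is_diff_eq (is_diff_add (is_diff_coord p iy) (is_diff_const l%:~R p))).
  apply/funext => h; rewrite cj /=.
  by rewrite !mulr0 !addr0 /iy ord_max2.
have -> : (fun y => deck n k l m y 0 (@rshift 2 2 j')) =
    (fun y => y 0 (@rshift 2 2 j') + int_vec R m (- n) 0 j').
  by apply/funext => y; rewrite /deck ptEr mxE basE.
apply: (is_diff_eq (is_diff_add (is_diff_coord p (@rshift 2 2 j'))
  (is_diff_const (int_vec R m (- n) 0 j') p))).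
apply/funext => h; rewrite cj /=.
by rewrite !mulr0 !addr0.
Qed.

Lemma base_frame_det p : \det (base_frame p) = 1.
Proof.
rewrite /base_frame -(mul_delta_mx (0 : 'I_1)) scalemxAl det_1BM -scalemxAr mxE.
by rewrite mul_delta_mx_0 // [X in _ * X]mxE mulr0 subr0.
Qed.

Lemma deck_y n k l m p :
  fib (deck n k l m p) ord0 ord_max = fib p ord0 ord_max + l%:~R.
Proof. by rewrite /deck fib_pt !mxE /= addr0. Qed.

Lemma deck_z1 n k l m p :
  bas (deck n k l m p) ord0 ord_max = bas p ord0 ord_max - n%:~R.
Proof. by rewrite /deck bas_pt !mxE /= mulrNz. Qed.

(** The twist adds [n * beta'] to the x-component of the second frame vector while z1 drops by n:
    the coefficient [- z1 * beta'] is designed so that these two changes agree. *)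
Lemma base_frame_deck n k l m p :
  base_frame p *m jacobian (deck n k l m) p = base_frame (deck n k l m p).
Proof.
have [_ ->] := deck_jacobian n k l m p.
rewrite /base_frame deck_y deck_z1 profile_deriveDz.
set b := derive1 beta _; set d := delta_mx _ _; set z := bas p _ _.
(* The shear direction squares to zero, which removes the term quadratic in [beta']. *)
have dd : d *m d = 0 by rewrite /d mul_delta_mx_0.
rewrite mulmxDr mulmx1 mulmxBl mul1mx -scalemxAl -scalemxAr dd !scaler0 subr0.
rewrite -addrA; congr (_ + _).
by rewrite mulrBl scalerBl opprB addrC.
Qed.

Lemma base_frame_continuous : continuous base_frame.
Proof.
move=> p.
have Hz : bas y ord0 ord_max @[y --> p] --> bas p ord0 ord_max.
  exact: (@continuous_mx_coord _ R _ _ (@bas R) p ord0 ord_max (@bas_continuous R p)).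
have Hy : derive1 beta (fib y ord0 ord_max) @[y --> p] -->
    derive1 beta (fib p ord0 ord_max).
  apply: (@continuous_comp _ _ _ (fun y => fib y ord0 ord_max)).
    exact: (@continuous_mx_coord _ R _ _ (@fib R) p ord0 ord_max (@fib_continuous R p)).
  exact: profile_derive_continuous.
exact: cvgB (cvg_cst _) (cvgZ (cvgM Hz Hy) (cvg_cst _)).
Qed.

End deck.

(** * The collar map and the frame along the seam *)

Section collar.
Context {R : realType}.
Implicit Types (p : 'rV[R]_4) (q w : 'rV[R]_2).

Lemma mul_fibre_block (A : 'M[R]_2) p :
  p *m (block_mx A 0 0 1%:M : 'M[R]_(2 + 2)) = pt (fib p *m A) (bas p).
Proof.
rewrite -{1}(pt_fib_bas p) /pt (@mul_row_block _ 1 2 2 2 2).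
by rewrite !mulmx0 addr0 add0r mulmx1.
Qed.

Lemma mul_fibre_blocks (A B : 'M[R]_2) :
  (block_mx A 0 0 1%:M : 'M[R]_(2 + 2)) *m (block_mx B 0 0 1%:M : 'M[R]_(2 + 2)) =
  block_mx (A *m B) 0 0 1%:M.
Proof.
by rewrite (@mulmx_block _ 2 2 2 2 2 2) !(mul0mx, mulmx0, mulmx1, addr0, add0r).
Qed.

Lemma fib_subE p q : sqnorm (fib p - q) =
  (p 0 ix - q 0 0) * (p 0 ix - q 0 0) + (p 0 iy - q 0 1) * (p 0 iy - q 0 1).
Proof. by rewrite sqnorm2 !mxE !expr2 -ord_max2. Qed.

Lemma collar_jacobian q rho r p : sqnorm (fib p - q) != 0 ->
  differentiable (collar_map q rho r) p /\
  jacobian (collar_map q rho r) p =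
    block_mx ((rho ^+ 2 / sqnorm (fib p - q)) *: (householder (fib p - q) *m r))
      0 0 1%:M.
Proof.
move=> S0; apply: jacobian_coord => j.
have Dx := is_diff_add (is_diff_coord p ix) (is_diff_const (- q 0 0) p).
have Dy := is_diff_add (is_diff_coord p iy) (is_diff_const (- q 0 1) p).
have DS := is_diff_add (is_diff_mul Dx Dx) (is_diff_mul Dy Dy).
case: (@split_ordP 2 2 j) => j' ->; last first.
  have -> : (fun y => collar_map q rho r y 0 (@rshift 2 2 j')) =
      (fun y => y 0 (@rshift 2 2 j')).
    by apply/funext => y; rewrite /collar_map ptEr basE.
  apply: (is_diff_eq (is_diff_coord p (@rshift 2 2 j'))).
  by apply/funext => h; rewrite mul_fibre_block ptEr basE.
have -> : (fun y => collar_map q rho r y 0 (@lshift 2 2 j')) =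
    (fun y => q 0 j' + (rho ^+ 2 *
      ((y 0 ix - q 0 0) * (y 0 ix - q 0 0) + (y 0 iy - q 0 1) * (y 0 iy - q 0 1))^-1) *
      ((y 0 ix - q 0 0) * r 0 j' + (y 0 iy - q 0 1) * r 1 j')).
  apply/funext => y; rewrite /collar_map ptEl fib_subE mxE; congr (_ + _).
  rewrite mxE; congr (_ * _); rewrite mxE !big_ord_recl big_ord0 !mxE addr0.
  by rewrite lift2_00 /iy ord_max2.
rewrite fib_subE in S0.
have D := (is_diff_add (is_diff_const (q 0 j') p) (is_diff_mul
  (is_diff_mul (is_diff_const (rho ^+ 2) p) (is_diff_inv DS S0))
  (is_diff_add (is_diff_mul Dx (is_diff_const (r 0 j') p))
               (is_diff_mul Dy (is_diff_const (r 1 j') p))))).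
apply: (is_diff_eq D).
apply/funext => h; rewrite mul_fibre_block ptEl fib_subE.
rewrite mxE !big_ord_recl big_ord0 lift2_00 addr0.
(* The entries are spelled out in the coordinates of p, so that what remains is an identity of
   rational functions for [field]. *)
have hE i k : (rho ^+ 2 / ((p 0 ix - q 0 0) * (p 0 ix - q 0 0) +
      (p 0 iy - q 0 1) * (p 0 iy - q 0 1))  *: (householder (fib p - q) *m r)) i k =
   rho ^+ 2 / ((p 0 ix - q 0 0) * (p 0 ix - q 0 0) +
      (p 0 iy - q 0 1) * (p 0 iy - q 0 1)) *
   (((i == 0)%:R - 2 / ((p 0 ix - q 0 0) * (p 0 ix - q 0 0) +
      (p 0 iy - q 0 1) * (p 0 iy - q 0 1)) * ((fib p - q) 0 i * (p 0 ix - q 0 0))) * r 0 k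
   + ((i == 1)%:R - 2 / ((p 0 ix - q 0 0) * (p 0 ix - q 0 0) +
      (p 0 iy - q 0 1) * (p 0 iy - q 0 1)) * ((fib p - q) 0 i * (p 0 iy - q 0 1))) * r 1 k).
  rewrite mxE; congr (_ * _); rewrite mxE !big_ord_recl big_ord0 lift2_00 addr0.
  rewrite !householderE fib_subE.
  have -> : (fib p - q) 0 0 = p 0 ix - q 0 0 by rewrite !mxE.
  by have -> : (fib p - q) 0 1 = p 0 iy - q 0 1 by rewrite !mxE /iy ord_max2.
rewrite !hE.
have -> : (fib p - q) 0 0 = p 0 ix - q 0 0 by rewrite !mxE.
have -> : (fib p - q) 0 1 = p 0 iy - q 0 1 by rewrite !mxE /iy ord_max2.
have -> : fib h 0 0 = h 0 ix by rewrite !mxE.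
have -> : fib h 0 1 = h 0 iy by rewrite !mxE /iy ord_max2.
rewrite /=.
move: S0; set w0 := p 0 ix - q 0 0; set w1 := p 0 iy - q 0 1 => S0.
set h0 := h 0 ix; set h1 := h 0 iy.
by field.
Qed.

End collar.

(** The truncation of s to [0, 1], in a form whose continuity is that of the norm. A piecewise
    linear cutoff suffices because frames only have to be continuous. *)
Definition clamp01 (R : realType) (s : R) : R := (1 + `|s| - `|1 - s|) / 2.

Section seam_frame.
Context {R : realType}.
Implicit Types (t s : R) (v w : 'rV[R]_2).

Lemma clamp01_le0 s : s <= 0 -> clamp01 s = 0.
Proof. by move=> s0; rewrite /clamp01 ler0_norm // ger0_norm; lra. Qed.

Lemma clamp01_id s : 0 <= s <= 1 -> clamp01 s = s.
Proof. by move=> /andP[s0 s1]; rewrite /clamp01 !ger0_norm; lra. Qed.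

Lemma clamp01_ge1 s : 1 <= s -> clamp01 s = 1.
Proof. by move=> s1; rewrite /clamp01 ger0_norm ?ler0_norm; lra. Qed.

Lemma clamp01_gt0 s : 0 < s -> 0 < clamp01 s.
Proof.
move=> s0; have [s1|s1] := leP 1 s; first by rewrite clamp01_ge1.
by rewrite clamp01_id // !ltW.
Qed.

Lemma clamp01_continuous : continuous (@clamp01 R).
Proof.
move=> s.
have H1 : `|y| @[y --> s] --> `|s| by exact: norm_continuous.
have H2 : `|1 - y| @[y --> s] --> `|1 - s|.
  exact: cvg_norm (cvgB (cvg_cst _) cvg_id).
exact: cvgM (cvgB (cvgD (cvg_cst _) H1) H2) (cvg_cst _).
Qed.

(* For t = 1 this is independent of w: tilting the two reflections of the plane
   into a third direction contracts their product, a rotation, to the identity. *)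
Definition tilt t w : 'rV[R]_4 := pt ((1 - t) *: w) (vec2 t 0).

Lemma tilt0 w : tilt 0 w = pt w 0.
Proof.
rewrite /tilt subr0 scale1r; congr (pt _ _); apply/rowP => i.
by rewrite !mxE; case: ifP.
Qed.

Lemma tilt1 v w : tilt 1 v = tilt 1 w.
Proof. by rewrite /tilt subrr !scale0r. Qed.

(** The two summands [(1 - t)^2 |w|^2] and [t^2] never vanish together, so the tilted reflection is
    defined throughout the homotopy. *)
Lemma tilt_neq0 t w : sqnorm w != 0 -> sqnorm (tilt t w) != 0.
Proof.
move=> w0; rewrite sqnorm_pt sqnormZ (sqnorm2 (vec2 _ _)) !mxE /=.
have wp : 0 < sqnorm w by rewrite lt_neqAle eq_sym w0 sqnorm_ge0.
rewrite gt_eqF //; have [->|t1] := eqVneq t 1.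
  by rewrite subrr expr0n /= mul0r add0r expr1n ltr_pwDl // expr0n.
rewrite ltr_pwDl //; last by rewrite addr_ge0 // sqr_ge0.
by rewrite mulr_gt0 // exprn_even_gt0 //= subr_eq0 eq_sym.
Qed.

Lemma tilt_continuous (T : topologicalType) (f : T -> R) (g : T -> 'rV[R]_2) x :
  {for x, continuous f} -> {for x, continuous g} ->
  {for x, continuous (fun y => tilt (f y) (g y))}.
Proof.
move=> fx gx; apply: cvg_mx => i j; rewrite (ord1 i) {i}.
case: (@split_ordP 2 2 j) => j' ->.
  have -> : (fun y => tilt (f y) (g y) 0 (@lshift 2 2 j')) =
      (fun y => (1 - f y) * g y 0 j').
    by apply/funext => y; rewrite /tilt ptEl mxE.
  exact: cvgM (cvgB (cvg_cst _) fx) (@continuous_mx_coord _ R _ _ g x 0 j' gx).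
have -> : (fun y => tilt (f y) (g y) 0 (@rshift 2 2 j')) =
    (fun y => if j' == ord0 then f y else 0).
  by apply/funext => y; rewrite /tilt ptEr mxE.
by case: (j' == ord0); [exact: fx | exact: cvg_cst].
Qed.

Definition fibre_scale s : 'M[R]_(2 + 2) := block_mx s%:M 0 0 1%:M.

Lemma det_fibre_scale s : \det (fibre_scale s) = s ^+ 2.
Proof. by rewrite /fibre_scale det_ublock det1 mulr1 det_scalar. Qed.

Lemma fibre_scale_continuous : continuous fibre_scale.
Proof.
move=> s; apply: cvg_mx => i j.
case: (split_ordP i) => i' ->; case: (split_ordP j) => j' ->.
- have -> : (fun y => fibre_scale y (lshift 2 i') (lshift 2 j')) =
      (fun y => y *+ (i' == j')).
    by apply/funext => y; rewrite /fibre_scale block_mxEul mxE.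
  by case: eqP => _ /=; [exact: cvg_id | exact: cvg_cst].
- have -> : (fun y => fibre_scale y (lshift 2 i') (rshift 2 j')) = (fun=> 0).
    by apply/funext => y; rewrite /fibre_scale block_mxEur mxE.
  exact: cvg_cst.
- have -> : (fun y => fibre_scale y (rshift 2 i') (lshift 2 j')) = (fun=> 0).
    by apply/funext => y; rewrite /fibre_scale block_mxEdl mxE.
  exact: cvg_cst.
- have -> : (fun y => fibre_scale y (rshift 2 i') (rshift 2 j')) =
      (fun=> (1%:M : 'M[R]_2) i' j').
    by apply/funext => y; rewrite /fibre_scale block_mxEdr.
  exact: cvg_cst.
Qed.

Variables (rho rho1 : R) (v : 'rV[R]_2).
Hypotheses (rho_gt0 : 0 < rho) (rho_lt : rho < rho1) (v_neq0 : sqnorm v != 0).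

Definition seam_cut w : R :=
  clamp01 ((sqnorm w - rho ^+ 2) / (rho1 ^+ 2 - rho ^+ 2)).

(** For |w| <= rho this is the inverse of the fibre part of the collar differential. The scale
    reaches 1 at rho; the tilt runs from 0 to 1 between the radii rho and rho1. *)
Definition seam_frame w : 'M[R]_(2 + 2) :=
  fibre_scale (clamp01 (sqnorm w / rho ^+ 2)) *m
  (householder (tilt (seam_cut w) v) *m householder (tilt (seam_cut w) w)).

Lemma seam_frame_det w : sqnorm w != 0 -> 0 < \det (seam_frame w).
Proof.
move=> w0; rewrite !det_mulmx det_fibre_scale !det_householder ?tilt_neq0 //.
rewrite mulrNN !mulr1 exprn_gt0 // clamp01_gt0 // divr_gt0 ?exprn_gt0 //.
by rewrite lt_neqAle eq_sym w0 sqnorm_ge0.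
Qed.

Lemma seam_frame_continuous w : sqnorm w != 0 -> {for w, continuous seam_frame}.
Proof.
move=> w0.
have cw := @sqnorm_continuous R 2 w.
have c1 : {for w, continuous (fun y => fibre_scale (clamp01 (sqnorm y / rho ^+ 2)))}.
  apply: (@continuous_comp _ _ _ (fun y : 'rV[R]_2 => clamp01 (sqnorm y / rho ^+ 2)));
    last exact: fibre_scale_continuous.
  apply: (@continuous_comp _ _ _ (fun y : 'rV[R]_2 => sqnorm y / rho ^+ 2));
    last exact: clamp01_continuous.
  exact: cvgM cw (cvg_cst _).
have c2 : {for w, continuous seam_cut}.
  apply: (@continuous_comp _ _ _ (fun y : 'rV[R]_2 =>
    (sqnorm y - rho ^+ 2) / (rho1 ^+ 2 - rho ^+ 2))); last exact: clamp01_continuous.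
  exact: cvgM (cvgB cw (cvg_cst _)) (cvg_cst _).
have hh (g : 'rV[R]_2 -> 'rV[R]_2) : {for w, continuous g} -> sqnorm (g w) != 0 ->
    {for w, continuous (fun y => householder (tilt (seam_cut y) (g y)))}.
  move=> gc g0; apply: (@continuous_comp _ _ _ (fun y => tilt (seam_cut y) (g y))).
    exact: tilt_continuous.
  by apply: householder_continuous; exact: tilt_neq0.
have cv := hh (fun=> v) (@cvg_cst _ v _ (nbhs w) (nbhs_filter w)) v_neq0.
have cw' := hh id (@cvg_id _ (nbhs w)) w0.
exact: (@continuous_mulmx _ R (2 + 2) (2 + 2) (2 + 2) _ _ w c1
  (@continuous_mulmx _ R (2 + 2) (2 + 2) (2 + 2) _ _ w cv cw')).
Qed.

(** At full tilt both reflections coincide, so their product is the identity. *)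
Lemma seam_frame_outer w : rho1 ^+ 2 <= sqnorm w -> seam_frame w = 1%:M.
Proof.
move=> w1.
have r1 : rho ^+ 2 < rho1 ^+ 2.
  by rewrite ltr_pXn2r // nnegrE; [exact: ltW | apply: ltW; exact: lt_trans rho_lt].
have cut1 : seam_cut w = 1.
  by rewrite /seam_cut clamp01_ge1 // ler_pdivlMr ?subr_gt0 // mul1r lerD2r.
have sw : sqnorm w != 0 by rewrite gt_eqF // (lt_le_trans _ w1) // exprn_gt0 // (lt_trans _ rho_lt).
rewrite /seam_frame cut1 (tilt1 v w) householderK ?tilt_neq0 // mulmx1.
rewrite clamp01_ge1; first by rewrite /fibre_scale -(@scalar_mx_block _ 2 2).
by rewrite ler_pdivlMr ?exprn_gt0 // mul1r (le_trans _ w1) // ltW.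
Qed.

Lemma seam_frame_inner w : 0 < sqnorm w -> sqnorm w <= rho ^+ 2 ->
  seam_frame w = block_mx ((sqnorm w / rho ^+ 2) *: (householder v *m householder w)) 0 0 1%:M.
Proof.
move=> w0 w1.
have r1 : rho ^+ 2 < rho1 ^+ 2.
  by rewrite ltr_pXn2r // nnegrE; [exact: ltW | apply: ltW; exact: lt_trans rho_lt].
have cut0 : seam_cut w = 0.
  rewrite /seam_cut clamp01_le0 // pmulr_lle0 ?invr_gt0 ?subr_gt0 //.
  by rewrite subr_le0.
rewrite /seam_frame cut0 !tilt0 !householder_pt clamp01_id; last first.
  by rewrite divr_ge0 ?sqnorm_ge0 ?exprn_ge0 ?(ltW rho_gt0) //= ler_pdivrMr ?exprn_gt0 // mul1r.
by rewrite /fibre_scale !mul_fibre_blocks mul_scalar_mx.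
Qed.

End seam_frame.

(** Seen from the copy [true], the seam frame is the coordinate frame, so all the interpolation
    takes place in the copy [false]. *)
Lemma seam_frame_collar (R : realType) (rho rho1 : R) (v q : 'rV[R]_2) (p : 'rV[R]_4) :
  0 < rho -> rho < rho1 -> sqnorm v != 0 ->
  0 < sqnorm (fib p - q) -> sqnorm (fib p - q) <= rho ^+ 2 ->
  seam_frame rho rho1 v (fib p - q) *m
    jacobian (collar_map q rho (householder v)) p = 1%:M.
Proof.
move=> r0 r01 v0 w0 w1.
have wn0 : sqnorm (fib p - q) != 0 by rewrite gt_eqF.
have [_ ->] := collar_jacobian rho (householder v) wn0.
rewrite seam_frame_inner // mul_fibre_blocks.
rewrite -scalemxAl -scalemxAr scalerA.
have -> : sqnorm (fib p - q) / rho ^+ 2 * (rho ^+ 2 / sqnorm (fib p - q)) = 1.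
  by field; rewrite wn0 gt_eqF.
rewrite scale1r mulmxA -(mulmxA (householder v)) householderK // mulmx1 householderK //.
by rewrite -(@scalar_mx_block _ 2 2).
Qed.

(** * The identifications near the removed disc *)

Section integral_near.
Context {R : realType} (beta : R -> R).
Hypothesis hbeta : twist_profile beta.

Definition integral_near (y : R) := \forall t \near y, exists k : int, beta t = k%:~R.

Lemma intr_small (k : int) : `|k%:~R : R| < 1 -> k = 0.
Proof. by rewrite -intr_norm -(mulr1z 1) ltr_int; lia. Qed.

(** In [integral_near] the integer may vary with t; continuity of [beta] keeps the variation below 1
    and so fixes it. *)
Lemma integral_near_const y : integral_near y ->
  exists k : int, \forall t \near y, beta t = k%:~R.
Proof.
move=> H; have [k yk] := nbhs_singleton H; exists k.
have C : \forall t \near y, `|beta y - beta t| < 1.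
  have /cvgrPdist_lt := @profile_continuous _ _ hbeta y; exact.
apply: filterS2 H C => t [k' ->]; rewrite yk -intrB => /intr_small kk.
by have -> : k' = k by lia.
Qed.

Lemma integral_near_derive y : integral_near y -> derive1 beta y = 0.
Proof.
move=> /integral_near_const[k H]; rewrite derive1E.
by rewrite (@near_eq_derive R R R beta (cst (k%:~R : R)) y 1 H) derive_cst.
Qed.

(** The twist is undone at height y + l, where [beta] has grown by l; this accounts for the
    correction n * l. *)
Lemma deck_inv n k l m p :
  deck beta (- n) (n * l - k) (- l) (- m) (deck beta n k l m p) = p.
Proof.
rewrite -[RHS]pt_fib_bas {1}/deck.
congr (pt _ _).
  rewrite /twist_pow deck_y profileDz // /deck fib_pt /twist_pow.
  apply/rowP => i; rewrite !mxE.
  by case: ifP => _; rewrite ?intrB ?intrM !mulrNz; ring.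
rewrite /deck bas_pt; apply/rowP => i; rewrite !mxE.
by case: ifP => _; rewrite ?opprK !mulrNz; ring.
Qed.

Lemma same_point_sym (p p' : 'rV[R]_4) :
  same_point beta p p' -> same_point beta p' p.
Proof.
move=> [k [l [m [n ->]]]]; exists (n * l - k), (- l), (- m), (- n).
by rewrite -[LHS](deck_inv n k l m).
Qed.

Lemma same_point_deck (p p' : 'rV[R]_4) : same_point beta p p' ->
  exists n k l m, p' = deck beta n k l m p.
Proof. by move=> [k [l [m [n ->]]]]; exists n, k, l, m. Qed.

Lemma deck_same_point n k l m (p : 'rV[R]_4) : same_point beta p (deck beta n k l m p).
Proof. by exists k, l, m, n. Qed.

Lemma same_point_refl (p : 'rV[R]_4) : same_point beta p p.
Proof.
exists 0, 0, 0, 0; rewrite -[LHS]pt_fib_bas; congr (pt _ _); apply/rowP => i;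
  rewrite !mxE ?oppr0 ?mul0r; case: ifP => _; by rewrite ?addr0.
Qed.

(** What remains of a deck transformation between two points near the same hole; see
    [same_point_hole]. *)
Definition base_shift (m n : int) : 'rV[R]_4 := pt 0 (int_vec R m (- n)).

Lemma fib_addr (p p' : 'rV[R]_4) : fib (p + p') = fib p + fib p'.
Proof. by apply/rowP => i; rewrite !mxE. Qed.

Lemma bas_addr (p p' : 'rV[R]_4) : bas (p + p') = bas p + bas p'.
Proof. by apply/rowP => i; rewrite !mxE. Qed.

Lemma fib_base_shift m n p : fib (p + base_shift m n) = fib p.
Proof. by rewrite fib_addr fib_pt addr0. Qed.

Lemma bas_base_shift m n p : bas (p + base_shift m n) = bas p + int_vec R m (- n).
Proof. by rewrite bas_addr bas_pt. Qed.

Lemma deck_integral n k l m (p : 'rV[R]_4) : integral_near (fib p ord0 ord_max) ->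
  exists k', fib (deck beta n k l m p) = fib p + int_vec R k' l.
Proof.
move=> /nbhs_singleton[b pb]; exists (n * b + k).
rewrite /deck fib_pt /twist_pow pb; apply/rowP => i; rewrite !mxE.
by case: ifP => _; rewrite ?intrD ?intrM; ring.
Qed.

Lemma base_shift_same_point m n (p : 'rV[R]_4) : integral_near (fib p ord0 ord_max) ->
  same_point beta p (p + base_shift m n).
Proof.
(* The lift of the twist may translate by a nonzero integer at this height; the shift by -(n * b)
   cancels it. *)
move=> /nbhs_singleton[b pb]; exists (- (n * b)), 0, m, n.
rewrite -[LHS]pt_fib_bas fib_base_shift bas_base_shift; congr (pt _ _).
rewrite /twist_pow pb; apply/rowP => i; rewrite !mxE.
by case: ifP => _; rewrite ?mulrNz ?intrM; ring.
Qed.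

Lemma base_shift_jacobian m n (p : 'rV[R]_4) :
  differentiable (fun z => z + base_shift m n) p /\
  jacobian (fun z => z + base_shift m n) p = 1%:M.
Proof.
apply: jacobian_coord => j.
have -> : (fun y => (y + base_shift m n) 0 j) =
    (fun y : 'rV[R]_4 => y 0 j + base_shift m n 0 j).
  by apply/funext => y; rewrite mxE.
apply: (is_diff_eq (is_diff_add (is_diff_coord p j) (is_diff_const _ p))).
by apply/funext => h; rewrite mulmx1 addr0.
Qed.

End integral_near.

(** * Lattice translates of the hole, and openness of the exterior and the collar *)

Section lattice.
Context {R : realType}.
Implicit Types (u w : 'rV[R]_2) (p : 'rV[R]_4).

Lemma int_vecD k l k' l' :
  int_vec R k l + int_vec R k' l' = int_vec R (k + k') (l + l').
Proof. by apply/rowP => i; rewrite !mxE; case: ifP => _; rewrite intrD. Qed.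

Lemma int_vecN k l : - int_vec R k l = int_vec R (- k) (- l).
Proof. by apply/rowP => i; rewrite !mxE; case: ifP => _; rewrite mulrNz. Qed.

Lemma int_vec0 : int_vec R 0 0 = 0.
Proof. by apply/rowP => i; rewrite !mxE; case: ifP. Qed.

Lemma int_vec_0 k l : int_vec R k l 0 0 = k%:~R. Proof. by rewrite mxE. Qed.
Lemma int_vec_1 k l : int_vec R k l 0 1 = l%:~R. Proof. by rewrite mxE. Qed.

Lemma sqr_lt_norm (a b : R) : 0 <= b -> a ^+ 2 < b ^+ 2 -> `|a| < b.
Proof. by move=> b0 ab; rewrite -(ltr_pXn2r (n := 2)) ?nnegrE // real_normK // num_real. Qed.

Lemma sqnorm_coord w i : w 0 i ^+ 2 <= sqnorm w.
Proof.
by case: (ord2P i) => ->; rewrite sqnorm2 ?lerDl ?lerDr sqr_ge0.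
Qed.

(** Both vectors have coordinates below 1/2 in absolute value, so the integers by which they differ
    are below 1. *)
Lemma lattice_translate_small w k l :
  sqnorm w < 2^-1 ^+ 2 -> sqnorm (w + int_vec R k l) < 2^-1 ^+ 2 -> k = 0 /\ l = 0.
Proof.
move=> w1 w2.
have H i : `|w 0 i| < 2^-1 /\ `|w 0 i + int_vec R k l 0 i| < 2^-1.
  split; apply: sqr_lt_norm; rewrite ?invr_ge0 //.
    exact: le_lt_trans (sqnorm_coord _ i) w1.
  have -> : w 0 i + int_vec R k l 0 i = (w + int_vec R k l) 0 i by rewrite [RHS]mxE.
  exact: le_lt_trans (sqnorm_coord _ i) w2.
have D i : `|int_vec R k l 0 i| < 1.
  have [] := H i; rewrite !ltr_norml => /andP[? ?] /andP[? ?].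
  by apply/andP; split; lra.
by split; apply: (@intr_small R); [rewrite -(int_vec_0 k l) | rewrite -(int_vec_1 k l)].
Qed.

Lemma exterior_translate q rho p p' k l : fib p' = fib p + int_vec R k l ->
  exterior q rho p -> exterior q rho p'.
Proof.
move=> E H a b; have := H (a - k) (b - l); rewrite E.
rewrite -int_vecD -int_vecN !opprD opprK !addrA.
by rewrite (addrAC _ (int_vec _ _ _) (- q)) (addrAC _ (int_vec _ _ _) (- int_vec _ _ _)).
Qed.

(** Within distance 1/2 of q no other translate of the disc can be met, so only the hole at q has to
    be avoided. *)
Lemma exterior_near_hole q rho p : rho < 2^-1 -> 0 < rho ->
  rho ^+ 2 <= sqnorm (fib p - q) -> sqnorm (fib p - q) < 2^-1 ^+ 2 ->
  exterior q rho p.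
Proof.
move=> r2 r0 p1 p2 k l; rewrite leNgt; apply/negP => H.
have [k0 l0] : - k = 0 /\ - l = 0.
  apply: (lattice_translate_small p2); rewrite -int_vecN.
  apply: lt_trans H _; rewrite ltr_pXn2r // nnegrE ?invr_ge0 //; exact: ltW.
move: H; have -> : k = 0 by lia.
have -> : l = 0 by lia.
by rewrite int_vec0 subr0 ltNge p1.
Qed.

Lemma exterior_int_sub q rho rho1 : 0 < rho -> rho <= rho1 ->
  @exterior_int R q rho1 `<=` exterior_int q rho.
Proof.
move=> r0 r1 p H k l; apply: le_lt_trans (H k l).
by rewrite ler_pXn2r // nnegrE ltW // (lt_le_trans r0).
Qed.

Lemma exterior_intW q rho : @exterior_int R q rho `<=` exterior q rho.
Proof. by move=> p H k l; apply: ltW. Qed.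

Lemma fib_dist_continuous q u :
  continuous (fun p : 'rV[R]_4 => sqnorm (fib p - q - u)).
Proof.
move=> p; apply: (@continuous_comp _ _ _ (fun p => fib p - q - u) (@sqnorm R 2));
  last exact: sqnorm_continuous.
exact: cvgB (cvgB (@fib_continuous R p) (cvg_cst _)) (cvg_cst _).
Qed.

Lemma fib_dist0_continuous q : continuous (fun p : 'rV[R]_4 => sqnorm (fib p - q)).
Proof.
move=> p; apply: (@continuous_comp _ _ _ (fun p => fib p - q) (@sqnorm R 2));
  last exact: sqnorm_continuous.
exact: cvgB (@fib_continuous R p) (cvg_cst _).
Qed.

(** An infinite intersection of open conditions: near a given point all but four of them hold
    automatically, because rho < 1/2. *)
Lemma exterior_int_open q rho : 0 < rho -> rho < 2^-1 -> open (@exterior_int R q rho).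
Proof.
move=> r0 r2.
suff H : forall p : 'rV[R]_4, exterior_int q rho p ->
    \forall z \near p, exterior_int q rho z.
  by rewrite openE => p /H.
move=> p Hp.
pose fl i := Num.floor ((fib p - q) 0 i).
have C i : \forall z \near p, `|fib p 0 i - fib z 0 i| < 2^-1.
  have /cvgrPdist_lt := @continuous_mx_coord _ R _ _ (@fib R) p 0 i (@fib_continuous R p).
  by apply; rewrite invr_gt0.
have H4 : \forall z \near p, forall a b : bool,
    rho ^+ 2 < sqnorm (fib z - q - int_vec R (fl 0 + a) (fl 1 + b)).
  have H (a b : bool) : \forall z \near p,
      rho ^+ 2 < sqnorm (fib z - q - int_vec R (fl 0 + a) (fl 1 + b)).
    exact: (cvgr_gt _ (@fib_dist_continuous q (int_vec R (fl 0 + a) (fl 1 + b)) p) _ (Hp _ _)).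
  by near=> z => -[] []; near: z; exact: H.
apply: filterS3 (C 0) (C 1) H4 => z z0 z1 z4 k l.
(* outside of the four lattice points around p a coordinate is at least 1/2 *)
have far i (j : int) : `|fib p 0 i - fib z 0 i| < 2^-1 ->
    (exists a : bool, j = fl i + a) \/ rho ^+ 2 < ((fib z - q) 0 i - j%:~R) ^+ 2.
  move=> zi; have [<-|j0] := eqVneq (fl i) j; first by left; exists false; rewrite addr0.
  have [<-|j1] := eqVneq (fl i + 1) j; first by left; exists true.
  right; have fz : (fib p - q) 0 i - (fib z - q) 0 i = fib p 0 i - fib z 0 i.
    by rewrite !mxE; ring.
  have := floor_le ((fib p - q) 0 i); have := floorD1_gt ((fib p - q) 0 i).
  rewrite -/(fl i) intrD => f1 f0.
  rewrite -fz ltr_norml in zi; case/andP: zi => zi1 zi2.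
  rewrite -[X in _ < X]real_normK ?num_real // ltr_pXn2r ?nnegrE ?(ltW r0) //.
  apply: lt_trans r2 _; rewrite ltr_normr.
  have [jl|jl] := ltP j (fl i).
    have : j%:~R + 1 <= (fl i)%:~R :> R by rewrite -(intrD R j 1) ler_int; lia.
    by move=> ?; apply/orP; left; lra.
  have : (fl i)%:~R + 2 <= j%:~R :> R by rewrite -(intrD R _ 2) ler_int; lia.
  by move=> ?; apply/orP; right; lra.
have cE (k' l' : int) : sqnorm (fib z - q - int_vec R k' l') =
    ((fib z - q) 0 0 - k'%:~R) ^+ 2 + ((fib z - q) 0 1 - l'%:~R) ^+ 2.
  rewrite sqnorm2 [(_ - int_vec _ _ _) 0 0]mxE [(_ - int_vec _ _ _) 0 1]mxE.
  by rewrite ![(- int_vec _ _ _) _ _]mxE int_vec_0 int_vec_1.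
have [[a ->]|fk] := far 0 k z0; last first.
  by rewrite cE; apply: lt_le_trans fk _; rewrite lerDl sqr_ge0.
have [[b ->]|fk] := far 1 l z1; first exact: z4.
by rewrite cE; apply: lt_le_trans fk _; rewrite lerDr sqr_ge0.
Unshelve. all: by end_near. Qed.

Lemma collar_open q rho rho' : open (@collar R q rho rho').
Proof.
suff H : forall p : 'rV[R]_4, collar q rho rho' p ->
    \forall z \near p, collar q rho rho' z.
  by rewrite openE => p /H.
move=> p /= /andP[p1 p2].
have C := @fib_dist0_continuous q p.
have H1 : \forall z \near p, (rho ^+ 2 / rho') ^+ 2 < sqnorm (fib z - q).
  by apply: (cvgr_gt _ C).
have H2 : \forall z \near p, sqnorm (fib z - q) < rho' ^+ 2.
  by apply: (cvgr_lt _ C).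
by apply: filterS2 H1 H2 => z z1 z2; apply/andP.
Qed.

Lemma collar_sub q rho rho2 rho' : 0 < rho -> 0 < rho2 -> rho2 <= rho' ->
  collar q rho rho2 `<=` @collar R q rho rho'.
Proof.
move=> r0 r2 r2' p /= /andP[p1 p2].
have r' : 0 < rho' := lt_le_trans r2 r2'.
have d (c : R) : 0 < c -> 0 <= rho ^+ 2 / c by move=> c0; rewrite divr_ge0 ?sqr_ge0 ?(ltW c0).
have le1 : rho ^+ 2 / rho' <= rho ^+ 2 / rho2 by rewrite ler_pM2l ?exprn_gt0 // lef_pV2.
apply/andP; split.
  by apply: le_lt_trans p1; apply: lerXn2r; rewrite ?nnegrE ?d.
by apply: lt_le_trans p2 _; apply: lerXn2r; rewrite ?nnegrE ?(ltW r2) ?(ltW r').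
Qed.

Lemma sqnorm_orthogonal (r : 'M[R]_2) w : r *m r^T = 1%:M -> sqnorm (w *m r) = sqnorm w.
Proof. by move=> rr; rewrite !sqnormE trmx_mul mulmxA -(mulmxA w) rr mulmx1. Qed.

Lemma local_diffeo_sub n (M : oriented_manifold R n) (W W' : set 'rV[R]_n) f :
  W' `<=` W -> local_diffeo (M := M) W f -> local_diffeo W' f.
Proof.
move=> WW [H1 H2 H3]; split=> [p /WW /H1 //|A AW|i p /WW]; last exact: H3.
by apply: H2; exact: subset_trans WW.
Qed.

End lattice.

(** * The global frame *)

Section gluing.
Context {R : realType} (beta : R -> R) (q : 'rV[R]_2) (rho rho1 rho2 : R).
Variable v : 'rV[R]_2.
Implicit Types p z : 'rV[R]_4.
Hypothesis hbeta : twist_profile beta.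
Hypotheses (rho_gt0 : 0 < rho) (rho_lt1 : rho < rho1) (rho1_lt2 : rho1 < rho2).
Hypothesis rho2_lt : rho2 < 2^-1.
Hypothesis integral_tube : forall y, `|y - q ord0 ord_max| < rho2 -> integral_near beta y.
Hypothesis v_neq0 : sqnorm v != 0.
Let r := householder v.
Hypothesis r_reflection : reflection r.

Let rho1_gt0 : 0 < rho1 := lt_trans rho_gt0 rho_lt1.
Let rho2_gt0 : 0 < rho2 := lt_trans rho1_gt0 rho1_lt2.
Let rho_lt2 : rho < rho2 := lt_trans rho_lt1 rho1_lt2.
Let sqr_lt (a b : R) : 0 < a -> a < b -> a ^+ 2 < b ^+ 2.
Proof. by move=> a0 ab; rewrite ltr_pXn2r // nnegrE ltW // (lt_trans a0). Qed.

Definition hole_dist p : R := sqnorm (fib p - q).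

Lemma hole_dist_integral p : hole_dist p < rho2 ^+ 2 ->
  integral_near beta (fib p ord0 ord_max).
Proof.
move=> H; apply: integral_tube; apply: sqr_lt_norm; first exact: ltW.
apply: le_lt_trans H; apply: le_trans (sqnorm_coord _ ord_max).
by rewrite [(fib p - q) _ _]mxE [(- q) _ _]mxE.
Qed.

(** In the tube a deck transformation moves the fibre coordinates by an integer vector, which is
    zero since both points are within 1/2 of q. *)
Lemma same_point_hole p p' : same_point beta p p' ->
  hole_dist p < rho2 ^+ 2 -> hole_dist p' < rho2 ^+ 2 ->
  exists m n, p' = p + base_shift m n.
Proof.
move=> /same_point_deck[n [k [l [m ->]]]] p1 p2.
have [k' E] := deck_integral n k l m (hole_dist_integral p1).
have r22 : rho2 ^+ 2 < 2^-1 ^+ 2 by exact: sqr_lt.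
have [k0 l0] : k' = 0 /\ l = 0.
  apply: (lattice_translate_small (lt_trans p1 r22)).
  by move: p2; rewrite /hole_dist E addrAC => /lt_trans; apply.
exists m, n; rewrite -[LHS]pt_fib_bas E k0 l0 int_vec0 addr0.
by rewrite -[RHS]pt_fib_bas fib_base_shift bas_base_shift /deck bas_pt.
Qed.

(** The distance from p to q is the distance from p' to some lattice translate of q, which
    [exterior_int] bounds below. *)
Lemma same_point_exterior_int c p p' : same_point beta p p' ->
  hole_dist p < rho2 ^+ 2 -> exterior_int q c p' -> c ^+ 2 < hole_dist p.
Proof.
move=> /same_point_deck[n [k [l [m ->]]]] p1 H.
have [k' E] := deck_integral n k l m (hole_dist_integral p1).
by have := H k' l; rewrite E addrAC addrK.
Qed.

Let kappa := collar_map q rho r.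

Lemma fib_kappa p : fib (kappa p) - q = (rho ^+ 2 / hole_dist p) *: ((fib p - q) *m r).
Proof. by rewrite /kappa /collar_map fib_pt addrAC subrr add0r. Qed.

Lemma bas_kappa p : bas (kappa p) = bas p.
Proof. by rewrite /kappa /collar_map bas_pt. Qed.

Lemma hole_dist_glue p : hole_dist (glue_map q r p) = hole_dist p.
Proof.
rewrite /hole_dist /glue_map fib_pt addrAC subrr add0r sqnorm_orthogonal //.
by have [] := r_reflection.
Qed.

Lemma glue_mapK p : glue_map q r (glue_map q r p) = p.
Proof.
rewrite /glue_map fib_pt bas_pt addrAC subrr add0r -mulmxA householderK //.
by rewrite mulmx1 addrC subrK pt_fib_bas.
Qed.

Lemma hole_dist_kappa p : hole_dist p != 0 ->
  hole_dist (kappa p) = rho ^+ 4 / hole_dist p.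
Proof.
move=> p0; rewrite {1}/hole_dist fib_kappa sqnormZ sqnorm_orthogonal.
  by rewrite -/(hole_dist p); field.
by have [] := r_reflection.
Qed.

Lemma kappaK p : hole_dist p != 0 -> kappa (kappa p) = p.
Proof.
move=> p0; have k0 : hole_dist (kappa p) != 0.
  by rewrite hole_dist_kappa // mulf_neq0 ?invr_neq0 // expf_neq0 // gt_eqF.
rewrite -[RHS]pt_fib_bas -[LHS]pt_fib_bas !bas_kappa; congr (pt _ _).
apply: (addIr (- q)); rewrite !fib_kappa hole_dist_kappa // -scalemxAl scalerA.
rewrite -mulmxA householderK // mulmx1.
rewrite (_ : _ * _ = 1) ?scale1r //; field.
by rewrite p0 gt_eqF.
Qed.

Lemma kappa_base_shift m n p : kappa (p + base_shift m n) = kappa p + base_shift m n.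
Proof.
rewrite -[RHS]pt_fib_bas fib_base_shift bas_base_shift bas_kappa.
rewrite -[LHS]pt_fib_bas bas_kappa bas_base_shift; congr (pt _ _).
by rewrite /kappa /collar_map !fib_pt fib_base_shift.
Qed.

Let collar2 := collar q rho rho2.

Lemma collar2P p : collar2 p -> 0 < hole_dist p /\ hole_dist p < rho2 ^+ 2.
Proof. by move=> /andP[p1 p2]; split=> //; apply: le_lt_trans p1; exact: sqr_ge0. Qed.

(** The inner radius [rho^2 / rho2] of the collar is the inverse of rho2 in the circle of radius
    rho. *)
Lemma kappa_inner p : collar2 p -> hole_dist p < rho ^+ 2 ->
  rho ^+ 2 < hole_dist (kappa p) /\ hole_dist (kappa p) < rho2 ^+ 2.
Proof.
move=> cp p1; have [p0 p2] := collar2P cp.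
rewrite hole_dist_kappa ?gt_eqF //; split.
  rewrite ltr_pdivlMr // (_ : rho ^+ 4 = rho ^+ 2 * rho ^+ 2); last by ring.
  by rewrite ltr_pM2l // exprn_gt0.
move/andP: cp => [cp _]; rewrite ltr_pdivrMr //.
move: cp; rewrite expr_div_n -exprM ltr_pdivrMr ?exprn_gt0 //.
by rewrite (mulrC (rho2 ^+ 2)).
Qed.

Lemma exterior_hole p : rho ^+ 2 <= hole_dist p -> hole_dist p < rho2 ^+ 2 ->
  exterior q rho p.
Proof.
move=> p1 p2; apply: exterior_near_hole => //.
  exact: lt_trans rho_lt2 rho2_lt.
exact: lt_trans p2 (sqr_lt rho2_gt0 rho2_lt).
Qed.

Lemma exterior_outer p : collar2 p -> rho ^+ 2 <= hole_dist p -> exterior q rho p.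
Proof. by move=> /collar2P[_ p2] p1; exact: exterior_hole. Qed.

Lemma exterior_inner p : collar2 p -> hole_dist p < rho ^+ 2 -> exterior q rho (kappa p).
Proof.
by move=> cp p1; have [k1 k2] := kappa_inner cp p1; apply: exterior_hole => //; exact: ltW.
Qed.

Lemma base_frame_tube p : hole_dist p < rho2 ^+ 2 -> base_frame beta p = 1%:M.
Proof.
move=> p1; rewrite /base_frame integral_near_derive //; last exact: hole_dist_integral.
by rewrite mulr0 scale0r subr0.
Qed.

Lemma hole_dist_continuous : continuous hole_dist.
Proof. exact: fib_dist0_continuous. Qed.

Variables (M : oriented_manifold R 4) (P : bool -> 'rV[R]_4 -> M).
Hypothesis P_glued : forall c p c' p', exterior q rho p -> exterior q rho p' ->
  (P c p = P c' p' <-> glued_point beta q rho r c p c' p').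

Lemma P_same c p p' : exterior q rho p -> exterior q rho p' ->
  P c p = P c p' <-> same_point beta p p'.
Proof. by move=> ep ep'; rewrite P_glued // /glued_point eqxx. Qed.

Lemma P_cross p p' : exterior q rho p -> exterior q rho p' ->
  P false p = P true p' <->
  exists p1, [/\ same_point beta p p1, hole_dist p1 = rho ^+ 2
                & same_point beta (glue_map q r p1) p'].
Proof. by move=> ep ep'; rewrite P_glued. Qed.

Let S := seam q rho r P.

Lemma seam_outer p : rho ^+ 2 <= hole_dist p -> S p = P false p.
Proof. by move=> p1; rewrite /S /seam -/(hole_dist p) p1. Qed.

Lemma seam_inner p : hole_dist p < rho ^+ 2 -> S p = P true (kappa p).
Proof. by move=> p1; rewrite /S /seam -/(hole_dist p) leNgt p1. Qed.

Lemma seam_base_shift m n p : collar2 p -> S (p + base_shift m n) = S p.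
Proof.
move=> cp; have [p0 p2] := collar2P cp.
have fE : hole_dist (p + base_shift m n) = hole_dist p by rewrite /hole_dist fib_base_shift.
have cp' : collar2 (p + base_shift m n) by rewrite /collar2 /collar /= fib_base_shift.
have [p1|p1] := leP (rho ^+ 2) (hole_dist p).
  rewrite !seam_outer ?fE //; apply/esym/P_same; try exact: exterior_outer.
    by apply: exterior_outer; rewrite ?fE.
  by apply: base_shift_same_point; exact: hole_dist_integral.
rewrite !seam_inner ?fE //; apply/esym/P_same; try exact: exterior_inner.
  by apply: exterior_inner; rewrite ?fE.
rewrite kappa_base_shift; apply: base_shift_same_point.
by apply: hole_dist_integral; have [] := kappa_inner cp p1.
Qed.

(** Copies meet only along the circle of radius rho. In the tube p' is a base translate of a point
    [glue_map q r p1] on that circle, and base translations keep the distance to q. *)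
Lemma P_cross_hole p p' : exterior q rho p -> exterior q rho p' ->
  P false p = P true p' -> hole_dist p' < rho2 ^+ 2 -> hole_dist p' = rho ^+ 2.
Proof.
move=> ep ep' /(P_cross ep ep')[p1 [_ p1E sp]] p2.
have g2 : hole_dist (glue_map q r p1) < rho2 ^+ 2.
  by rewrite hole_dist_glue p1E; exact: sqr_lt.
have [m [n ->]] := same_point_hole sp g2 p2.
by rewrite /hole_dist fib_base_shift -/(hole_dist _) hole_dist_glue.
Qed.

Lemma P_cross_exterior_int_r p p' : exterior q rho p -> exterior_int q rho p' ->
  P false p <> P true p'.
Proof.
move=> ep ep' /(P_cross ep (exterior_intW ep'))[p1 [_ p1E sp]].
have g2 : hole_dist (glue_map q r p1) < rho2 ^+ 2.
  by rewrite hole_dist_glue p1E; exact: sqr_lt.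
by have := same_point_exterior_int sp g2 ep'; rewrite hole_dist_glue p1E ltxx.
Qed.

Lemma P_cross_exterior_int_l p p' : exterior_int q rho p -> exterior q rho p' ->
  P false p <> P true p'.
Proof.
move=> ep ep' /(P_cross (exterior_intW ep) ep')[p1 [sp p1E _]].
have g2 : hole_dist p1 < rho2 ^+ 2 by rewrite p1E; exact: sqr_lt.
by have := same_point_exterior_int (same_point_sym hbeta sp) g2 ep; rewrite p1E ltxx.
Qed.

(** Injectivity of the seam parametrization up to base translations. *)
Lemma seam_eq p p' : collar2 p -> collar2 p' -> S p = S p' ->
  exists m n, p' = p + base_shift m n.
Proof.
move=> cp cp'; have [p0 p2] := collar2P cp; have [p0' p2'] := collar2P cp'.
have [p1|p1] := leP (rho ^+ 2) (hole_dist p);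
have [p1'|p1'] := leP (rho ^+ 2) (hole_dist p').
- rewrite !seam_outer // => /P_same sp.
  by apply: same_point_hole => //; apply: sp; exact: exterior_outer.
(* A mixed identification would put [kappa p'] on the circle, but inversion sends the strict inside
   to the strict outside. *)
- rewrite seam_outer // seam_inner // => E.
  have [k1 k2] := kappa_inner cp' p1'.
  have := P_cross_hole (exterior_outer cp p1) (exterior_inner cp' p1') E k2.
  by move=> H; move: k1; rewrite H ltxx.
- rewrite seam_inner // seam_outer // => /esym E.
  have [k1 k2] := kappa_inner cp p1.
  have := P_cross_hole (exterior_outer cp' p1') (exterior_inner cp p1) E k2.
  by move=> H; move: k1; rewrite H ltxx.
- rewrite !seam_inner // => /P_same sp.
  have [k1 k2] := kappa_inner cp p1; have [k1' k2'] := kappa_inner cp' p1'.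
  have [|m [n E]] := same_point_hole _ k2 k2'.
    by apply: sp; exact: exterior_inner.
  exists m, n; rewrite -(@kappaK p') ?gt_eqF // E kappa_base_shift kappaK //.
  by rewrite gt_eqF.
Qed.

Let rho1_lt : rho1 < 2^-1 := lt_trans rho1_lt2 rho2_lt.
Let rho_lt : rho < 2^-1 := lt_trans rho_lt1 rho1_lt.

Let G p := seam_frame rho rho1 v (fib p - q).

Lemma near_exterior_int a p : 0 < a -> a < 2^-1 -> exterior_int q a p ->
  \forall z \near p, exterior_int q a z.
Proof.
by move=> a0 a1 ep; apply: open_nbhs_nbhs; split=> //; exact: exterior_int_open.
Qed.

Lemma near_collar2 p : collar2 p -> \forall z \near p, collar2 z.
Proof. by move=> cp; apply: open_nbhs_nbhs; split=> //; exact: collar_open. Qed.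

Lemma near_deck n k l m a p : 0 < a -> a < 2^-1 ->
  exterior_int q a (deck beta n k l m p) ->
  \forall z \near p, exterior_int q a (deck beta n k l m z).
Proof.
move=> a0 a1 ep; have [dd _] := deck_jacobian hbeta n k l m p.
exact: (differentiable_continuous dd (near_exterior_int a0 a1 ep)).
Qed.

Lemma deck_intertwines c a p p' : rho <= a -> a < 2^-1 ->
  exterior_int q a p -> exterior_int q a p' -> P c p = P c p' ->
  intertwines (P c) (P c) (base_frame beta) (base_frame beta) p p'.
Proof.
move=> ra a1 ep ep'; have a0 : 0 < a := lt_le_trans rho_gt0 ra.
have ext z : exterior_int q a z -> exterior q rho z.
  by move=> /(exterior_int_sub rho_gt0 ra); exact: exterior_intW.
move=> /(P_same c (ext _ ep) (ext _ ep')) /same_point_deck[n [k [l [m E]]]].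
have [dd _] := deck_jacobian hbeta n k l m p.
exists (deck beta n k l m); split=> //; last by rewrite E; exact: base_frame_deck.
rewrite E in ep'; apply: filterS2 (near_exterior_int a0 a1 ep) (near_deck a0 a1 ep').
move=> z ez ez'; apply/esym/P_same; [exact: ext | exact: ext |].
exact: deck_same_point.
Qed.

Lemma seam_intertwines p p' : collar2 p -> collar2 p' -> S p = S p' ->
  intertwines S S G G p p'.
Proof.
move=> cp cp' /(seam_eq cp cp')[m [n ->]].
have [dd jj] := base_shift_jacobian m n p.
exists (fun z => z + base_shift m n); split=> //.
  by apply: filterS (near_collar2 cp) => z; exact: seam_base_shift.
by rewrite jj mulmx1 /G fib_base_shift.
Qed.

(** The point p lies strictly inside the circle, since interior points of the copy [true] are not
    glued to the other copy. The change of parameters is therefore [kappa] followed by a deck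
    transformation. *)
Lemma seam_true_intertwines p p' : collar2 p -> exterior_int q rho p' ->
  S p = P true p' -> intertwines S (P true) G (base_frame beta) p p'.
Proof.
move=> cp ep'; have [p0 p2] := collar2P cp.
have [p1|p1] := leP (rho ^+ 2) (hole_dist p).
  by rewrite seam_outer // => /(P_cross_exterior_int_r (exterior_outer cp p1) ep').
rewrite seam_inner //.
move=> /(P_same true (exterior_inner cp p1) (exterior_intW ep')) /same_point_deck[n [k [l [m E]]]].
have p0' : sqnorm (fib p - q) != 0 by rewrite gt_eqF.
have [dk jk] := collar_jacobian rho r p0'.
have [dd _] := deck_jacobian hbeta n k l m (kappa p).
exists (deck beta n k l m \o kappa); split=> //.
- exact: differentiable_comp.
- have near_inner : \forall z \near p, hole_dist z < rho ^+ 2.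
    exact: (cvgr_lt _ (@hole_dist_continuous p)).
  rewrite E in ep'.
  have near_ext := differentiable_continuous dk (near_deck rho_gt0 rho_lt ep').
  apply: filterS3 (near_collar2 cp) near_inner near_ext => z cz z1 ez.
  rewrite seam_inner //; apply/esym/P_same; first exact: exterior_inner.
    exact: exterior_intW.
  exact: deck_same_point.
(* [kappa] carries G to the identity matrix, which is [base_frame] at [kappa p] because [beta] is
   locally constant there. *)
rewrite (jacobian_comp dk dd) mulmxA /G seam_frame_collar // ?ltW //.
have [_ k2] := kappa_inner cp p1.
by rewrite -(base_frame_tube k2) E; exact: base_frame_deck.
Qed.

(** Membership of p' in the exterior of radius rho1 forces p beyond rho1, where G is already the
    coordinate frame. *)
Lemma seam_false_intertwines p p' : collar2 p -> exterior_int q rho1 p' ->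
  S p = P false p' -> intertwines S (P false) G (base_frame beta) p p'.
Proof.
move=> cp ep'; have [p0 p2] := collar2P cp.
have ep1 := exterior_int_sub rho_gt0 (ltW rho_lt1) ep'.
have [p1|p1] := leP (rho ^+ 2) (hole_dist p); last first.
  by rewrite seam_inner // => /esym /(P_cross_exterior_int_l ep1 (exterior_inner cp p1)).
rewrite seam_outer // => /(P_same false (exterior_outer cp p1) (exterior_intW ep1)) sp.
have p3 := same_point_exterior_int sp p2 ep'.
have [n [k [l [m E]]]] := same_point_deck sp.
have [dd _] := deck_jacobian hbeta n k l m p.
exists (deck beta n k l m); split=> //.
- have near_outer : \forall z \near p, rho1 ^+ 2 < hole_dist z.
    exact: (cvgr_gt _ (@hole_dist_continuous p)).
  rewrite E in ep'.
  apply: filterS3 (near_collar2 cp) near_outer (near_deck rho1_gt0 rho1_lt ep') => z cz z1 ez.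
  have z2 : rho ^+ 2 <= hole_dist z.
    by apply: ltW; apply: lt_trans z1; exact: sqr_lt.
  rewrite seam_outer //; apply/esym/P_same; first exact: exterior_outer.
    by apply: exterior_intW; exact: exterior_int_sub (ltW rho_lt1) _ ez.
  exact: deck_same_point.
rewrite /G seam_frame_outer // ?ltW //.
by rewrite -(base_frame_tube p2) E; exact: base_frame_deck.
Qed.

Hypothesis P_cover : forall x : M, exists c p, exterior q rho p /\ P c p = x.
Hypothesis P_diffeo : forall c, local_diffeo (exterior_int q rho) (P c).
Hypothesis S_diffeo : local_diffeo collar2 S.

(* [None] is the seam, [Some c] the copy c; on the copy [false] the twisted
   collar frame [G] is merged into [base_frame] between the radii rho and rho1. *)
Let dom (a : option bool) : set 'rV[R]_4 :=
  if a is Some c then exterior_int q (if c then rho else rho1) else collar2.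
Let par (a : option bool) : 'rV[R]_4 -> M := if a is Some c then P c else S.
Let frame (a : option bool) : 'rV[R]_4 -> 'M[R]_4 :=
  if a is Some _ then base_frame beta else G.

(** Translating by (-k, -l) moves the hole in question to q; with n = 0 the twist does not
    intervene. *)
Lemma near_hole_seam p k l : exterior q rho p ->
  sqnorm (fib p - q - int_vec R k l) < rho2 ^+ 2 ->
  exists p', [/\ exterior q rho p', same_point beta p p',
    hole_dist p' = sqnorm (fib p - q - int_vec R k l) & collar2 p'].
Proof.
move=> ep p2; pose p' := deck beta 0 (- k) (- l) 0 p.
have E : fib p' = fib p + int_vec R (- k) (- l).
  rewrite /p' /deck fib_pt /twist_pow; congr (_ + _).
  by apply/rowP => i; rewrite !mxE mul0r; case: ifP => _; rewrite addr0.
have hE : hole_dist p' = sqnorm (fib p - q - int_vec R k l).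
  by rewrite /hole_dist E -int_vecN addrAC.
have ep' := exterior_translate E ep.
exists p'; split=> //; first exact: deck_same_point.
apply/andP; split; last by rewrite -/(hole_dist p') hE.
apply: (@lt_le_trans _ _ (rho ^+ 2)); last first.
  by have := ep' 0 0; rewrite int_vec0 subr0.
rewrite ltr_pXn2r ?nnegrE ?(ltW rho_gt0) ?divr_ge0 ?sqr_ge0 ?(ltW rho2_gt0) //.
by rewrite ltr_pdivrMr // expr2 ltr_pM2l.
Qed.

Lemma par_cover x : exists a p, dom a p /\ par a p = x.
Proof.
have [[] [p [ep <-]]] := P_cover x.
  have [ip|/existsNP[k /existsNP[l /negP]]] := pselect (exterior_int q rho p).
    by exists (Some true), p.
  rewrite -leNgt => pkl.
  have pE : sqnorm (fib p - q - int_vec R k l) = rho ^+ 2.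
    by apply/le_anti; rewrite pkl; exact: ep.
  have [|p' [ep' sp hE cp']] := near_hole_seam ep _ (k := k) (l := l).
    by rewrite pE; exact: sqr_lt.
  rewrite pE in hE.
  (* A boundary point of the copy [true] is covered from the other side: on the circle the seam is
     given by [P false], and the gluing map is an involution. *)
  have gE : hole_dist (glue_map q r p') = rho ^+ 2 by rewrite hole_dist_glue.
  have cg : collar2 (glue_map q r p').
    move: cp'; rewrite /collar2 /collar /= -/(hole_dist p').
    by rewrite -/(hole_dist (glue_map _ _ _)) hole_dist_glue.
  have eg : exterior q rho (glue_map q r p') by apply: exterior_outer; rewrite // gE.
  exists None, (glue_map q r p'); split=> //=.
  rewrite seam_outer ?gE //.
  rewrite ((P_same true ep ep').2 sp).
  apply/(P_cross eg ep'); exists (glue_map q r p'); split=> //.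
    exact: same_point_refl.
  by rewrite glue_mapK; exact: same_point_refl.
have [ip|/existsNP[k /existsNP[l /negP]]] := pselect (exterior_int q rho1 p).
  by exists (Some false), p.
rewrite -leNgt => pkl.
have [|p' [ep' sp hE cp']] := near_hole_seam ep _ (k := k) (l := l).
  by apply: le_lt_trans pkl _; exact: sqr_lt.
exists None, p'; split=> //=; rewrite seam_outer; last by rewrite hE; exact: ep.
by rewrite ((P_same false ep ep').2 sp).
Qed.

Lemma glued_frame : exists E, oriented_frame_field [set: M] E.
Proof.
apply: (oriented_frame_field_glue (W := dom) (f := par) (G := frame)).
- case=> [c|] /=; last exact: collar_open.
  by apply: exterior_int_open; case: c.
- case=> [c|] //=; apply: local_diffeo_sub (P_diffeo c).
  by apply: exterior_int_sub => //; case: c => //; exact: ltW.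
- case=> [c|] p /= Hp; first exact: base_frame_continuous.
  have [p0 _] := collar2P Hp.
  apply: (@continuous_comp _ _ _ (fun p => fib p - q) (seam_frame rho rho1 v)).
    exact: cvgB (@fib_continuous R p) (cvg_cst _).
  by apply: seam_frame_continuous; rewrite // gt_eqF.
- case=> [c|] p /= Hp; first by rewrite base_frame_det.
  by have [p0 _] := collar2P Hp; apply: seam_frame_det; rewrite // gt_eqF.
- exact: par_cover.
case=> [c|] [c'|] p p' /= Hp Hp' E; last by left; exact: seam_intertwines.
- case: c c' Hp Hp' E => [] [] Hp Hp' E.
  + by left; exact: (deck_intertwines (lexx rho) rho_lt).
  (* The interiors of the two copies are disjoint in M, so the mixed cases are void. *)
  + have H := exterior_int_sub rho_gt0 (ltW rho_lt1) Hp'.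
    by have := P_cross_exterior_int_r (exterior_intW H) Hp (esym E).
  + have H := exterior_int_sub rho_gt0 (ltW rho_lt1) Hp.
    by have := P_cross_exterior_int_r (exterior_intW H) Hp' E.
  + by left; exact: (deck_intertwines (ltW rho_lt1) rho1_lt).
(* The changes of parameters were constructed from the seam to the copies, hence the reversed
   direction. *)
- right; case: c Hp E => Hp /esym E; first exact: seam_true_intertwines.
  exact: seam_false_intertwines.
left; case: c' Hp' E => Hp' E; first exact: seam_true_intertwines.
exact: seam_false_intertwines.
Qed.

End gluing.

(** Being locally integral is an open condition on the height, so the closed interval of heights
    reached by the disc can be enlarged; only its two endpoints need room. *)
Lemma disc_integral_tube (R : realType) (beta : R -> R) (q : 'rV[R]_2) (rho rho' : R) :
  disc_off_support beta q rho -> rho < rho' ->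
  exists rho2, [/\ rho < rho2, rho2 <= rho'
    & forall y, `|y - q ord0 ord_max| < rho2 -> integral_near beta y].
Proof.
move=> [rho_gt0 _ H] rr'; set y0 := q ord0 ord_max.
have near_end y : `|y - y0| <= rho ->
    exists2 e, 0 < e & forall z, `|y - z| < e -> integral_near beta z.
  by move=> /H /nbhs_interior /nbhs_ballP[e e0 He]; exists e.
have [|e1 e1_gt0 H1] := near_end (y0 + rho).
  by rewrite addrAC subrr add0r gtr0_norm.
have [|e2 e2_gt0 H2] := near_end (y0 - rho).
  by rewrite addrAC subrr add0r normrN gtr0_norm.
exists (Num.min rho' (rho + Num.min e1 e2)); split.
- by rewrite lt_min rr' ltrDl lt_min e1_gt0.
- by rewrite ge_min lexx.
- move=> y; rewrite lt_min => /andP[_]; rewrite -ltrBlDl lt_min => /andP[y1 y2].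
  have [yr|yr] := leP `|y - y0| rho; first exact: H.
  have [yy|yy] := leP 0 (y - y0).
    move: yr y1; rewrite ger0_norm // => yr y1.
    by apply: H1; rewrite ltr_norml; apply/andP; split; lra.
  move: yr y2; rewrite ltr0_norm // => yr y2.
  by apply: H2; rewrite ltr_norml; apply/andP; split; lra.
Qed.

Theorem mainTheorem3 (R : realType)
    (beta : R -> R) (q : 'rV[R]_2) (rho : R) (r : 'M[R]_2)
    (M : oriented_manifold R 4)
    (hbeta : twist_profile beta)
    (hD : disc_off_support beta q rho)
    (hr : reflection r)
    (hclosed : compact [set: M])
    (hM : glued_manifold beta q rho r M) :
  spin_manifold M.
Proof.
have [P [P_cover P_glued P_diffeo [rho' [rr' rho'_lt S_diffeo]]]] := hM.
have [v [v0 rE]] := reflection_householder hr; subst r.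
have [rho2 [rr2 r2r' integral_tube]] := disc_integral_tube hD rr'.
have [rho_gt0 _ _] := hD.
have rho2_lt := le_lt_trans r2r' rho'_lt.
(* The midpoint serves as rho1; any radius strictly between rho and rho2 would do. *)
have rr1 : rho < (rho + rho2) / 2 by lra.
have r12 : (rho + rho2) / 2 < rho2 by lra.
have S_diffeo2 := local_diffeo_sub
  (collar_sub rho_gt0 (lt_trans rho_gt0 rr2) r2r') S_diffeo.
have [E HE] := glued_frame hbeta rho_gt0 rr1 r12 rho2_lt integral_tube v0 hr
  P_glued P_cover P_diffeo S_diffeo2.
exact: spin_manifold_of_frame HE.
Qed.
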